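(* For every complex $z$ with $\operatorname{Re}(z)>0$, the digamma function $\psi(z)=\frac{\Gamma'(z)}{\Gamma(z)}$ has the convergent factorial expansion $$\psi(z)=\log z-\frac1{2z}-\sum_{m=2}^{\infty}\frac{p_1(m)}{\prod_{k=0}^{m-1}(z+k)},$$ where $$p_1(m)=\frac{(-1)^{m}}{2m}\sum_{k=2}^{m}\frac{k!\,(k-1)}{(k+1)!}S_m^{(k)} .$$
   Context: $S_m^{(k)}$ denotes the (signed) Stirling number of the first kind, defined by $\prod_{k=0}^{m-1}(x-k)=\sum_{k=0}^{m}S_m^{(k)}x^k$. The logarithm is the principal branch. (The number $p_1(m)$ is the coefficient of $\alpha$ in the polynomial $b_m(\alpha)=\frac1m\int_{\alpha-1}^{\alpha}\left(x+\frac12-\alpha\right)\prod_{k=0}^{m-1}(k+x)\,dx$.) *)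

(* Defs.v *)
(* Stdlib's real numbers with Coquelicot for complex analysis; MathComp is used
   only for formal polynomials over R, through the ring structure on R given by
   Rstruct. *)
From mathcomp Require Import all_boot all_algebra.
From mathcomp Require Import Rstruct.
From Stdlib Require Import Reals.
From Coquelicot Require Import Coquelicot.

Set Implicit Arguments.
Unset Strict Implicit.
Unset Printing Implicit Defensive.

(* The key R now belongs to R_scope. *)
Delimit Scope ring_scope with ring.
Local Open Scope R_scope.

Definition Cexp (z : C) : C :=
  (exp (Re z) * cos (Im z), exp (Re z) * sin (Im z)).

(* Principal argument, with values in (-PI, PI] for z <> 0: acos takes its
   values in [0, PI], and the sign is that of Im z. *)
Definition Carg (z : C) : R :=
  if Rle_dec 0 (Im z) then acos (Re z / Cmod z) else - acos (Re z / Cmod z).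

Definition Clog (z : C) : C := (ln (Cmod z), Carg z).

(* Euler's integral of t^(z-1) exp(-t) over (0, +oo), where
   t^(z-1) = exp ((z-1) ln t).  It represents the Gamma function for Re z > 0
   only, which is an open set and the only domain needed here; outside of it
   the value is unspecified. *)
Definition CGamma (z : C) : C :=
  @RInt_gen C_R_CompleteNormedModule
    (fun t : R => (Cexp ((z - 1) * ln t) * exp (- t))%C)
    (at_right 0) (Rbar_locally p_infty).

(* C_derive is the derivative with respect to the complex variable. *)
Definition digamma (z : C) : C := (C_derive CGamma z / CGamma z)%C.

(* Signed Stirling number of the first kind S_m^(k): the coefficient of 'X^k in
   'X ('X - 1) ... ('X - (m-1)). *)
Definition stirling1 (m k : nat) : R :=
  ((\prod_(i < m) ('X - (i%:R)%:P) : {poly R})`_k)%ring.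

Definition p1 (m : nat) : R :=
  (-1) ^ m / (2 * INR m) *
  sum_n_m (fun k : nat =>
             INR k`! * (INR k - 1) / INR (k.+1)`! * stirling1 m k) 2 m.

Definition bpol (m : nat) (alpha : R) : R :=
  / INR m *
  RInt (fun x : R =>
          (x + / 2 - alpha) * \big[Rmult/1]_(k < m) (INR k + x))
       (alpha - 1) alpha.

(* z (z + 1) ... (z + m - 1) *)
Definition Crising (z : C) (m : nat) : C :=
  \big[Cmult/RtoC 1]_(k < m) (z + INR k)%C.

(* Main.v *)
Require Import Defs.
From mathcomp Require Import all_boot all_algebra.
From mathcomp Require Import Rstruct.
From Stdlib Require Import Reals Factorial Lra.
From Coquelicot Require Import Coquelicot.

Local Open Scope R_scope.

(** Write [I_m] for the integral over [0, 1] of the Pochhammer symbol [(-x)_m]. Since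
    [S_m(1) = 0] for [m >= 2], [m p_1(m) = - I_m]. Integrating in [x] the Newton expansion
      [1 / (z + x) = sum_m (-x)_m / (z)_(m+1)]
    gives [log (z + 1) - log z = sum_m I_m / (z)_(m+1)], and [m / (z)_(m+1)] is the difference
    [1 / (z)_m - 1 / (z+1)_m]; hence the right-hand side [T] of the expansion satisfies
    [T (z + 1) = T z + 1 / z], as the digamma function does. It remains to compare both with
    [log n] at [z + n]. For [T] this follows from [|sum_m p_1(m) / (z)_m| <= (1 + x) / x^2],
    [x = Re z], obtained by telescoping [(m-1)! / (x)_m]. For digamma, Gamma and its derivative
    at [z + N + 1] are integrals of [s^z] and of [s^z ln s] against the measure
    [t^N e^(-t) dt], [s = t / N], whose mass concentrates at [s = 1]. *)

(** * Integrals over the positive half-line *)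

(** The defect digamma - [T] has period 1, so its value at z is its limit along z + n with z fixed.
    Hence neither holomorphy of the series nor a uniqueness theorem is involved: all limits are
    pointwise in z. The Gamma side is the expensive one. [CGamma] is an improper Riemann integral
    with complex values, and explicit estimates replace dominated convergence: differentiation under
    the integral sign comes from a Taylor remainder quadratic in h, and concentration at s = 1 from
    polynomial moments, which are quotients of factorials, with |s - 1| <= d / 2 + (s - 1)^2 / (2 d)
    taking care of the absolute value. The quotient in [digamma] also requires that Gamma have no
    zero: the asymptotics give this far to the right, and the functional equation carries it back to
    z. The claim on b_m meets the rest only in m p_1(m) = - I_m: the substitution x = alpha - u and
    a Taylor expansion in alpha express the coefficients as integrals in u, and one integration by
    parts identifies the coefficient of alpha with - I_m / m. *)

Definition is_RInt0oo {V : NormedModule R_AbsRing} (f : R -> V) (l : V) : Prop :=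
  is_RInt_gen f (at_right 0) (Rbar_locally p_infty) l.

Lemma filter_prod_0oo (P : R * R -> Prop) :
  (forall a b, 0 < a -> a <= b -> P (a, b)) ->
  filter_prod (at_right 0) (Rbar_locally p_infty) P.
Proof.
move=> HP; apply: (@Filter_prod _ _ _ _ _ (fun a => 0 < a < 1) (fun b => 1 < b)).
- exists (mkposreal 1 Rlt_0_1) => y /= Hy y0; split=> //.
  move: Hy; rewrite /ball /= /AbsRing_ball /= /abs /minus /plus /opp /=.
  by move/Rabs_def2; lra.
- by exists 1.
- by move=> a b Ha Hb; apply: HP; lra.
Qed.

Lemma ex_RInt_pos {V : CompleteNormedModule R_AbsRing} (f : R -> V) a b :
  (forall t, 0 < t -> continuous f t) -> 0 < a -> 0 < b -> ex_RInt f a b.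
Proof.
move=> cf a0 b0; apply: ex_RInt_continuous => t [Ht _]; apply: cf.
by apply: Rlt_le_trans Ht; apply: Rmin_glb_lt.
Qed.

(** Continuity makes every integral between positive bounds exist, so the limit of a relation in
    [is_RInt_gen] becomes the limit of a function, to which the Cauchy criterion and the composition
    of limits apply. *)
Lemma is_RInt0oo_lim {V : CompleteNormedModule R_AbsRing} (f : R -> V) l :
  (forall t, 0 < t -> continuous f t) ->
  is_RInt0oo f l <->
  filterlim (fun ab : R * R => RInt f ab.1 ab.2)
    (filter_prod (at_right 0) (Rbar_locally p_infty)) (locally l).
Proof.
move=> cf; split=> H P HP.
- move: (H P HP); rewrite /filtermapi /filtermap; apply: filter_imp => -[a b] /= [y [Hy Py]].
  by rewrite (is_RInt_unique _ _ _ _ Hy).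
- move: (H P HP); rewrite /filtermapi /filtermap => H2.
  have H3 : filter_prod (at_right 0) (Rbar_locally p_infty)
      (fun ab : R * R => 0 < ab.1 /\ 0 < ab.2).
    by apply: filter_prod_0oo => a b a0 ab /=; lra.
  apply: filter_imp (filter_and _ _ H2 H3) => -[a b] /= [HP' [a0 b0]].
  exists (RInt f a b); split=> //.
  by apply: RInt_correct; apply: ex_RInt_pos.
Qed.

(** The absolute value on the right allows the bounds in either order, as the Cauchy criterion below
    produces them. *)
Lemma norm_RInt_pos {V : CompleteNormedModule R_AbsRing} (f : R -> V) (g : R -> R) a b :
  (forall t, 0 < t -> continuous f t) -> (forall t, 0 < t -> continuous g t) ->
  (forall t, 0 < t -> norm (f t) <= g t) -> 0 < a -> 0 < b ->
  norm (RInt f a b) <= Rabs (RInt g a b).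
Proof.
move=> cf cg fg; wlog ab : a b / a <= b => [Hw a0 b0|a0 b0].
  case: (Rle_dec a b) => ab; first exact: Hw.
  rewrite -(opp_RInt_swap f b a); last exact: ex_RInt_pos.
  rewrite -(opp_RInt_swap g b a); last exact: ex_RInt_pos.
  rewrite norm_opp /opp /= Rabs_Ropp; apply: Hw => //; lra.
apply: Rle_trans (Rle_abs _).
apply: (norm_RInt_le f g a b) => //.
- by move=> x Hx; apply: fg; lra.
- by apply: RInt_correct; apply: ex_RInt_pos.
- by apply: RInt_correct; apply: ex_RInt_pos.
Qed.

#[local] Instance proper_0oo :
  ProperFilter (filter_prod (at_right 0) (Rbar_locally p_infty)).
Proof. by apply: filter_prod_proper. Qed.

Lemma is_RInt0oo_le {V : CompleteNormedModule R_AbsRing} (f : R -> V) (g : R -> R) lf lg :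
  (forall t, 0 < t -> norm (f t) <= g t) ->
  is_RInt0oo f lf -> is_RInt0oo g lg -> norm lf <= lg.
Proof.
move=> fg; apply: RInt_gen_norm.
- by apply: filter_prod_0oo.
- by apply: filter_prod_0oo => a b a0 ab x /= Hx; apply: fg; lra.
Qed.

(** Comparison test, by the Cauchy criterion on pairs of bounds: two integrals of [f] differ by two
    end pieces, which are dominated by those of [g]. *)
Lemma ex_RInt0oo_le {V : CompleteNormedModule R_AbsRing} (f : R -> V) (g : R -> R) lg :
  (forall t, 0 < t -> continuous f t) -> (forall t, 0 < t -> continuous g t) ->
  (forall t, 0 < t -> norm (f t) <= g t) -> is_RInt0oo g lg ->
  exists lf, is_RInt0oo f lf.
Proof.
move=> cf cg fg /(is_RInt0oo_lim _ lg cg) Hg.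
have [l Hl] : exists l, filterlim (fun ab : R * R => RInt f ab.1 ab.2)
    (filter_prod (at_right 0) (Rbar_locally p_infty)) (locally l); last first.
  by exists l; apply/is_RInt0oo_lim.
apply/filterlim_locally_cauchy => eps.
have e4 : 0 < eps / 4 by have := cond_pos eps; lra.
pose B := ball lg (mkposreal _ e4).
have HB : locally lg B by apply: locally_ball.
have [Q S HQ HS HQS] := Hg _ HB.
pose Q' a := Q a /\ 0 < a; pose S' b := S b /\ 0 < b.
have HQ' : at_right 0 Q'.
  apply: filter_and => //; exists (mkposreal 1 Rlt_0_1) => y _; done.
have HS' : Rbar_locally p_infty S' by apply: filter_and => //; exists 0.
exists (fun ab => Q' ab.1 /\ S' ab.2); split; first by apply: (Filter_prod _ _ _ Q' S').
move=> [a b] [a' b'] /= [[Qa a0] [Sb b0]] [[Qa' a'0] [Sb' b'0]].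
have bnd x y : Q x -> S y -> Rabs (RInt g x y - lg) < eps / 4 by move=> Qx Sy; apply: (HQS x y).
have exf x y : 0 < x -> 0 < y -> ex_RInt f x y by apply: ex_RInt_pos.
have exg x y : 0 < x -> 0 < y -> ex_RInt g x y by apply: ex_RInt_pos.
apply: norm_compat1.
have -> : minus (RInt f a' b') (RInt f a b) = plus (RInt f a' a) (RInt f b b').
  rewrite -(RInt_Chasles f a' a b'); try exact: exf.
  rewrite -(RInt_Chasles f a b b'); try exact: exf.
  rewrite /minus -!plus_assoc; congr plus.
  by rewrite plus_comm -plus_assoc plus_opp_l plus_zero_r.
apply: Rle_lt_trans (norm_triangle _ _) _.
have h1 := norm_RInt_pos _ _ _ _ cf cg fg a'0 a0.
have h2 := norm_RInt_pos _ _ _ _ cf cg fg b0 b'0.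
(* Each end piece of [g] is a difference of two integrals that lie within eps / 4 of [lg], hence is
   below eps / 2. *)
have c1 : RInt g a' a + RInt g a b = RInt g a' b by apply: RInt_Chasles; apply: exg.
have c2 : RInt g a b + RInt g b b' = RInt g a b' by apply: RInt_Chasles; apply: exg.
have k1 := Rabs_def2 _ _ (bnd _ _ Qa Sb).
have k2 := Rabs_def2 _ _ (bnd _ _ Qa' Sb).
have k3 := Rabs_def2 _ _ (bnd _ _ Qa Sb').
have k4 : Rabs (RInt g a' a) < eps / 2 by apply: Rabs_def1; lra.
have k5 : Rabs (RInt g b b') < eps / 2 by apply: Rabs_def1; lra.
lra.
Qed.

Lemma is_RInt0oo_unique {V : CompleteNormedModule R_AbsRing} (f : R -> V) l1 l2 :
  is_RInt0oo f l1 -> is_RInt0oo f l2 -> l1 = l2.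
Proof. by move=> /is_RInt_gen_unique <- /is_RInt_gen_unique <-. Qed.

Lemma is_RInt0oo_ext {V : NormedModule R_AbsRing} (f g : R -> V) l :
  (forall t, 0 < t -> f t = g t) -> is_RInt0oo f l -> is_RInt0oo g l.
Proof.
move=> fg; apply: is_RInt_gen_ext; apply: filter_prod_0oo => a b a0 ab x /= Hx.
by apply: fg; move: Hx; rewrite Rmin_left //; lra.
Qed.

Lemma is_RInt0oo_plus {V : NormedModule R_AbsRing} (f g : R -> V) lf lg :
  is_RInt0oo f lf -> is_RInt0oo g lg ->
  is_RInt0oo (fun t => plus (f t) (g t)) (plus lf lg).
Proof. exact: is_RInt_gen_plus. Qed.

Lemma is_RInt0oo_scal {V : NormedModule R_AbsRing} (f : R -> V) k l :
  is_RInt0oo f l -> is_RInt0oo (fun t => scal k (f t)) (scal k l).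
Proof. exact: is_RInt_gen_scal. Qed.

(** The hypothesis on [F] is about integrals on compact intervals, not derivatives, so that
    complex-valued primitives, found componentwise, also qualify. *)
Lemma is_RInt0oo_primitive {V : CompleteNormedModule R_AbsRing} (F f : R -> V) l0 loo :
  (forall a b, 0 < a -> a <= b -> is_RInt f a b (minus (F b) (F a))) ->
  (forall t, 0 < t -> continuous f t) ->
  filterlim F (at_right 0) (locally l0) -> filterlim F (Rbar_locally p_infty) (locally loo) ->
  is_RInt0oo f (minus loo l0).
Proof.
move=> dF cf H0 Hoo.
apply/(is_RInt0oo_lim _ (minus loo l0) cf).
apply: (filterlim_ext_loc (fun ab : R * R => minus (F ab.2) (F ab.1))).
  by apply: filter_prod_0oo => a b a0 ab /=; apply/esym/is_RInt_unique/dF.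
apply: (filterlim_comp_2 (fun ab : R * R => F ab.2) (fun ab : R * R => opp (F ab.1)) plus
  (G := locally loo) (H := locally (opp l0))).
- exact: (filterlim_comp _ _ _ snd F _ (Rbar_locally p_infty) _ filterlim_snd Hoo).
- apply: (filterlim_comp _ _ _ (fun ab : R * R => F ab.1) opp _ (locally l0)).
    exact: (filterlim_comp _ _ _ fst F _ (at_right 0) _ filterlim_fst H0).
  exact: filterlim_opp.
- exact: filterlim_plus.
Qed.

Lemma is_RInt0oo_derive (F f : R -> R) l0 loo :
  (forall t, 0 < t -> is_derive F t (f t)) -> (forall t, 0 < t -> continuous f t) ->
  filterlim F (at_right 0) (locally l0) -> filterlim F (Rbar_locally p_infty) (locally loo) ->
  is_RInt0oo f (loo - l0).
Proof.
move=> dF cf; apply: (is_RInt0oo_primitive (V := R_CompleteNormedModule)) => // a b a0 ab.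
by apply: is_RInt_derive => x; rewrite Rmin_left // => Hx; [apply: dF|apply: cf]; lra.
Qed.

Lemma filterlim_at_right0 (f : R -> R) l :
  (forall eps, 0 < eps -> exists d, 0 < d /\ forall t, 0 < t < d -> Rabs (f t - l) < eps) ->
  filterlim f (at_right 0) (locally l).
Proof.
move=> H P [eps He]; have [d [d0 Hd]] := H _ (cond_pos eps).
exists (mkposreal _ d0) => y Hy y0; apply: He; apply: Hd; split=> //.
move: Hy; rewrite /ball /= /AbsRing_ball /= /abs /minus /plus /opp /=.
by move/Rabs_def2; lra.
Qed.

Lemma filterlim_p_infty (f : R -> R) l :
  (forall eps, 0 < eps -> exists M, forall t, M < t -> Rabs (f t - l) < eps) ->
  filterlim f (Rbar_locally p_infty) (locally l).
Proof.
move=> H P [eps He]; have [M HM] := H _ (cond_pos eps).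
by exists M => y Hy; apply: He; apply: HM.
Qed.

(** * Complex exponentials *)

Lemma is_RInt_C (f : R -> C) a b (l : C) :
  is_RInt (fun t => Re (f t)) a b (Re l) -> is_RInt (fun t => Im (f t)) a b (Im l) ->
  is_RInt (V := C_R_NormedModule) f a b l.
Proof. by case: l => x y hr hi; apply: is_RInt_fct_extend_pair. Qed.

Lemma continuous_C (T : UniformSpace) (f : T -> C) t :
  continuous (fun t => Re (f t)) t -> continuous (fun t => Im (f t)) t ->
  continuous (U := C_UniformSpace) f t.
Proof.
move=> hr hi P [eps He].
have h1 : locally t (fun x => ball (Re (f t)) eps (Re (f x))) by apply: hr; apply: locally_ball.
have h2 : locally t (fun x => ball (Im (f t)) eps (Im (f x))) by apply: hi; apply: locally_ball.
rewrite /filtermap; apply: filter_imp (filter_and _ _ h1 h2) => x [b1 b2].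
by apply: He; split.
Qed.

Lemma Cexp_add z w : Cexp (z + w) = (Cexp z * Cexp w)%C.
Proof.
case: z => a b; case: w => c d; rewrite /Cexp /Cmult /=.
by rewrite exp_plus cos_plus sin_plus; congr pair; ring.
Qed.

Lemma Cmod_Cexp z : Cmod (Cexp z) = exp (Re z).
Proof.
rewrite /Cmod /Cexp /=.
rewrite (_ : _ + _ = (exp (Re z))² * ((sin (Im z))² + (cos (Im z))²)); last by rewrite /Rsqr; ring.
by rewrite sin2_cos2 Rmult_1_r sqrt_Rsqr //; apply/Rlt_le/exp_pos.
Qed.

Lemma Cexp_RtoC (x : R) : Cexp x = RtoC (exp x).
Proof. by rewrite /Cexp /= cos_0 sin_0 /RtoC; congr pair; ring. Qed.

Lemma norm_C (z : C) : norm (V := C_R_NormedModule) z = Cmod z.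
Proof. by rewrite Cmod_norm. Qed.

Lemma Cmod_RInt01_le (f : R -> C) l M :
  (forall x, 0 <= x <= 1 -> Cmod (f x) <= M) ->
  is_RInt (V := C_R_NormedModule) f 0 1 l -> Cmod l <= M.
Proof.
move=> fM fl; rewrite (_ : M = (1 - 0) * M); last ring.
rewrite -norm_C; apply: norm_RInt_le_const _ _ fl; first lra.
by move=> x Hx; rewrite norm_C; apply: fM.
Qed.

(** This integral along the segment from 0 to w yields the first two Taylor remainder bounds of the
    exponential without power series. *)
Lemma is_RInt_Cexp (w : C) :
  is_RInt (V := C_R_NormedModule) (fun s : R => (w * Cexp (s * w))%C) 0 1 (Cexp w - 1)%C.
Proof.
case: w => a b; apply: is_RInt_C.
- apply: (is_RInt_ext (fun s => exp (s * a) * (a * cos (s * b) - b * sin (s * b)))).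
    by move=> s _; rewrite /Cexp /=; rewrite !Rmult_0_l !Rminus_0_r !Rplus_0_r; ring.
  rewrite (_ : Re _ = minus (exp (1 * a) * cos (1 * b)) (exp (0 * a) * cos (0 * b))); last first.
    by rewrite /= /minus /plus /opp /= !Rmult_1_l !Rmult_0_l exp_0 cos_0; ring.
  apply: (is_RInt_derive (fun s => exp (s * a) * cos (s * b))) => s _; first by auto_derive => //; ring.
  by apply: (ex_derive_continuous (V := R_NormedModule)); auto_derive.
- apply: (is_RInt_ext (fun s => exp (s * a) * (a * sin (s * b) + b * cos (s * b)))).
    by move=> s _; rewrite /Cexp /=; rewrite !Rmult_0_l !Rminus_0_r !Rplus_0_r; ring.
  rewrite (_ : Im _ = minus (exp (1 * a) * sin (1 * b)) (exp (0 * a) * sin (0 * b))); last first.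
    by rewrite /= /minus /plus /opp /= !Rmult_1_l !Rmult_0_l exp_0 sin_0; ring.
  apply: (is_RInt_derive (fun s => exp (s * a) * sin (s * b))) => s _; first by auto_derive => //; ring.
  by apply: (ex_derive_continuous (V := R_NormedModule)); auto_derive.
Qed.

Lemma exp_incr x y : x <= y -> exp x <= exp y.
Proof. by case=> [/exp_increasing/Rlt_le|->] //; apply: Rle_refl. Qed.

(** The sum bounds the maximum of 1 and exp x, whatever the sign of x. *)
Lemma exp_le_1plus s x : 0 <= s <= 1 -> exp (s * x) <= 1 + exp x.
Proof.
move=> Hs; have := exp_pos x; case: (Rle_dec x 0) => hx h0.
  have : exp (s * x) <= exp 0 by apply: exp_incr; nra.
  by rewrite exp_0; lra.
have : exp (s * x) <= exp x by apply: exp_incr; nra.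
by lra.
Qed.

Lemma Cmod_Cexp_sub1 w : Cmod (Cexp w - 1) <= Cmod w * (1 + exp (Re w)).
Proof.
apply: Cmod_RInt01_le (is_RInt_Cexp w).
move=> s Hs; rewrite Cmod_mult Cmod_Cexp re_scal_l.
by apply: Rmult_le_compat_l; [exact: Cmod_ge_0|exact: exp_le_1plus].
Qed.

Lemma Cmod_Cexp_sub1_sub w : Cmod (Cexp w - 1 - w) <= Cmod w ^ 2 * (2 + exp (Re w)).
Proof.
have H : is_RInt (V := C_R_NormedModule) (fun s : R => (w * Cexp (s * w) - w)%C) 0 1 (Cexp w - 1 - w)%C.
  have := is_RInt_minus _ _ _ _ _ _ (is_RInt_Cexp w) (is_RInt_const (V := C_R_NormedModule) 0 1 w).
  by rewrite Rminus_0_r scal_one.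
apply: Cmod_RInt01_le H.
move=> s Hs.
rewrite (_ : (w * Cexp (s * w) - w)%C = (w * (Cexp (s * w) - 1))%C); last by ring.
rewrite Cmod_mult /= Rmult_1_r Rmult_assoc.
apply: Rmult_le_compat_l; first exact: Cmod_ge_0.
apply: Rle_trans (Cmod_Cexp_sub1 _) _; rewrite Cmod_mult re_scal_l Cmod_R Rabs_pos_eq; last lra.
have h1 := exp_le_1plus _ (Re w) Hs; have h2 := Cmod_ge_0 w; have h3 := exp_pos (s * Re w).
have h4 : s * Cmod w <= Cmod w by nra.
by apply: Rmult_le_compat; nra.
Qed.

Lemma continuous_Re (f : R -> C) t :
  continuous (U := C_UniformSpace) f t -> continuous (fun t => Re (f t)) t.
Proof. by move=> cf; apply: (continuous_comp f fst) => //; apply: continuous_fst. Qed.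

Lemma continuous_Im (f : R -> C) t :
  continuous (U := C_UniformSpace) f t -> continuous (fun t => Im (f t)) t.
Proof. by move=> cf; apply: (continuous_comp f snd) => //; apply: continuous_snd. Qed.

Lemma continuous_RtoC (f : R -> R) t :
  continuous f t -> continuous (U := C_UniformSpace) (fun t => RtoC (f t)) t.
Proof. by move=> cf; apply: continuous_C => //=; apply: continuous_const. Qed.

Lemma continuous_Cmult (f g : R -> C) t :
  continuous (U := C_UniformSpace) f t -> continuous (U := C_UniformSpace) g t ->
  continuous (U := C_UniformSpace) (fun t => (f t * g t)%C) t.
Proof.
move=> cf cg; have := (continuous_Re _ _ cf, continuous_Im _ _ cf, continuous_Re _ _ cg, continuous_Im _ _ cg).
move=> [[[fr fi] gr] gi]; apply: continuous_C => /=.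
- apply: (continuous_minus (V := R_NormedModule)); exact: (continuous_mult (K := R_AbsRing)).
- apply: (continuous_plus (V := R_NormedModule)); exact: (continuous_mult (K := R_AbsRing)).
Qed.

Lemma continuous_Cplus (f g : R -> C) t :
  continuous (U := C_UniformSpace) f t -> continuous (U := C_UniformSpace) g t ->
  continuous (U := C_UniformSpace) (fun t => (f t + g t)%C) t.
Proof. exact: (continuous_plus (V := C_R_NormedModule)). Qed.

Lemma continuous_ln t : 0 < t -> continuous ln t.
Proof. by move=> t0; apply: (ex_derive_continuous (V := R_NormedModule)); auto_derive. Qed.

Lemma continuous_Cexp_ln (z : C) t :
  0 < t -> continuous (U := C_UniformSpace) (fun t => Cexp (z * ln t)) t.
Proof.
by move=> t0; apply: continuous_C; rewrite /Cexp /=;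
  apply: (ex_derive_continuous (V := R_NormedModule)); auto_derive.
Qed.

Lemma continuous_exp_opp t : continuous (fun t => exp (- t)) t.
Proof. by apply: (ex_derive_continuous (V := R_NormedModule)); auto_derive. Qed.

Lemma filterlim_Cmod (F : (R -> Prop) -> Prop) {FF : Filter F} (f : R -> C) (r : R -> R) :
  F (fun t => Cmod (f t) <= r t) -> filterlim r F (locally 0) ->
  filterlim f F (locally (RtoC 0)).
Proof.
move=> fr r0 P [eps He].
have h : F (fun t => ball 0 eps (r t)) by apply: r0; apply: locally_ball.
rewrite /filtermap; apply: filter_imp (filter_and _ _ fr h) => t [h1 h2]; apply: He.
apply: (norm_compat1 (V := C_R_NormedModule)).
change (norm (V := C_R_NormedModule) (minus (f t) zero) < eps).
rewrite minus_zero_r norm_C.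
apply: Rle_lt_trans h1 _; move: h2.
rewrite /ball /= /AbsRing_ball /= /abs /minus /plus /opp /=.
by move/Rabs_def2; lra.
Qed.

Lemma Cexp_ln_add1 (z : C) t : 0 < t -> Cexp (z * ln t) = (t * Cexp ((z - 1) * ln t))%C.
Proof.
move=> t0; rewrite -{2}(exp_ln t) // -Cexp_RtoC -Cexp_add; congr Cexp; ring.
Qed.

(** The integrand is the derivative of t^z rho(t) with t^(z-1) factored out. Taking rho = e^(-t)
    leads to the functional equation of Gamma, and rho = e^(-t) ln t to that of its derivative. *)
Lemma is_RInt_Cexp_ln (z : C) (rho rho' : R -> R) a b :
  (forall t, 0 < t -> is_derive rho t (rho' t)) -> (forall t, 0 < t -> continuous rho' t) ->
  0 < a -> a <= b ->
  is_RInt (V := C_R_NormedModule)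
    (fun t => (Cexp ((z - 1) * ln t) * (z * rho t + t * rho' t))%C) a b
    (minus (Cexp (z * ln b) * rho b)%C (Cexp (z * ln a) * rho a)%C).
Proof.
move=> dr cr a0 ab; set f : R -> C := fun t => _.
have cf t : 0 < t -> continuous (U := C_UniformSpace) f t.
  move=> t0; apply: continuous_Cmult; first exact: continuous_Cexp_ln.
  have crho : continuous rho t.
    by apply: (ex_derive_continuous (V := R_NormedModule)); exists (rho' t); apply: dr.
  apply: continuous_Cplus; apply: continuous_Cmult.
  - exact: continuous_const.
  - exact: continuous_RtoC.
  - by apply: continuous_RtoC; apply: continuous_id.
  - by apply: continuous_RtoC; apply: cr.
(* Differentiating t^z rho(t) mechanically leaves the factor t^z, so the integrand is first put in
   that form. *)
have fE t : 0 < t -> f t = (Cexp (z * ln t) * (z * (rho t / t)%R + rho' t))%C.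
  move=> t0; rewrite Cexp_ln_add1 // /f RtoC_div; last lra.
  field.
  by move=> /(f_equal fst) /=; lra.
have dF t : 0 < t -> is_derive (fun t => Re (Cexp (z * ln t) * rho t)%C) t (Re (f t)) /\
    is_derive (fun t => Im (Cexp (z * ln t) * rho t)%C) t (Im (f t)).
  move=> t0; rewrite fE //; case: z {fE f cf} => x y; rewrite /Cexp /=.
  split; auto_derive; try (by repeat split => //; exists (rho' t); apply: dr);
   rewrite (is_derive_unique _ _ _ (dr _ t0)) /Rminus; field; lra.
apply: is_RInt_C.
- apply: (is_RInt_derive (fun t => Re (Cexp (z * ln t) * rho t)%C)) => t; rewrite Rmin_left // => Ht.
    by case: (dF t); first lra.
  by apply: continuous_Re; apply: cf; lra.
- apply: (is_RInt_derive (fun t => Im (Cexp (z * ln t) * rho t)%C)) => t; rewrite Rmin_left // => Ht.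
    by case: (dF t); first lra.
  by apply: continuous_Im; apply: cf; lra.
Qed.

(** * Gamma integrals *)

(** The real Gamma integrand t^(a-1) e^(-t). As |t^(z-1)| = t^(Re z - 1), it is the modulus of the
    complex one at a = Re z. *)
Definition gamma_weight (a t : R) : R := exp ((a - 1) * ln t) * exp (- t).

Lemma gamma_weight_gt0 a t : 0 < gamma_weight a t.
Proof. by apply: Rmult_lt_0_compat; apply: exp_pos. Qed.

Lemma continuous_gamma_weight a t : 0 < t -> continuous (gamma_weight a) t.
Proof.
by move=> t0; apply: (ex_derive_continuous (V := R_NormedModule)); rewrite /gamma_weight; auto_derive.
Qed.

Lemma gamma_weight_mul a c t :
  exp (c * ln t) * gamma_weight a t = gamma_weight (a + c) t.
Proof. by rewrite /gamma_weight -!exp_plus; congr exp; ring. Qed.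

(** The constant is the value of (1 + t)^p e^(-t) at its critical point 1 + t = p; the bound is e^u
    >= 1 + u at u = ln ((1 + t) / p). *)
Lemma exp_opp_bound p : 0 < p ->
  exists C, 0 < C /\ forall t, 0 <= t -> exp (- t) <= C * exp (- p * ln (1 + t)).
Proof.
move=> p0; exists (exp (1 - p + p * ln p)); split=> [|t t0]; first exact: exp_pos.
rewrite -exp_plus; apply: exp_incr.
have := exp_ineq1_le (ln (1 + t) - ln p).
rewrite exp_plus exp_Ropp !exp_ln; try lra.
move=> h; have : p * (1 + (ln (1 + t) - ln p)) <= p * ((1 + t) * / p) by apply: Rmult_le_compat_l; lra.
rewrite (_ : p * ((1 + t) * / p) = 1 + t); [lra|field; lra].
Qed.

(* The majorant is the derivative of (t / (1 + t))^a, up to a constant. *)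
Lemma ex_gamma_weight a : 0 < a -> exists l, is_RInt0oo (gamma_weight a) l.
Proof.
move=> a0; have [C [C0 HC]] : exists C, 0 < C /\ forall t, 0 <= t ->
    exp (- t) <= C * exp (- (a + 1) * ln (1 + t)) by apply: exp_opp_bound; lra.
pose F t := exp (a * (ln t - ln (1 + t))).
pose g t := F t * (a * (/ t - / (1 + t))).
have dF t : 0 < t -> is_derive F t (g t).
  by move=> t0; rewrite /g /F; auto_derive; [lra|rewrite /Rminus; field; lra].
have cg t : 0 < t -> continuous g t.
  move=> t0; apply: (ex_derive_continuous (V := R_NormedModule)); rewrite /g /F; auto_derive.
  by repeat split; lra.
have Hg : is_RInt0oo g (1 - 0).
  apply: (is_RInt0oo_derive F) => //.
    apply: filterlim_at_right0 => eps e0; exists (exp (ln eps / a)); split=> [|t [t0 ht]].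
      exact: exp_pos.
    rewrite Rminus_0_r Rabs_pos_eq; last exact/Rlt_le/exp_pos.
    rewrite -(exp_ln eps) //; apply: exp_increasing.
    have h1 : ln t < ln eps / a by rewrite -(ln_exp (ln eps / a)); apply: ln_increasing.
    have h2 : 0 < ln (1 + t) by rewrite -ln_1; apply: ln_increasing; lra.
    have h3 : a * ln t < ln eps.
      rewrite (_ : ln eps = a * (ln eps / a)); last by field; lra.
      exact: Rmult_lt_compat_l.
    by nra.
  (* Since ln (1 + t) - ln t <= 1 / t, one has 1 - a / t <= F t <= 1. *)
  apply: filterlim_p_infty => eps e0; exists (a / eps) => t ht.
  have ae : 0 < a / eps by apply: Rdiv_lt_0_compat.
  have t0 : 0 < t by lra.
  have hle : ln t <= ln (1 + t) by apply/Rlt_le/ln_increasing; lra.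
  have hF : F t <= 1 by rewrite -exp_0; apply: exp_incr; nra.
  have hl : ln (1 + t) - ln t <= / t.
    rewrite -ln_div; try lra.
    have := exp_ineq1_le (ln ((1 + t) / t)).
    rewrite exp_ln; last by apply: Rdiv_lt_0_compat; lra.
    rewrite (_ : (1 + t) / t = 1 + / t); [lra|field; lra].
  have hF2 := exp_ineq1_le (a * (ln t - ln (1 + t))); rewrite -/(F t) in hF2.
  have h4 : a * / t < eps.
    apply: (Rmult_lt_reg_r t) => //; rewrite Rmult_assoc Rinv_l; last lra.
    by move: (Rmult_lt_compat_r _ _ _ e0 ht); rewrite /Rdiv Rmult_assoc Rinv_l; lra.
  by apply: Rabs_def1; nra.
have HF := is_RInt0oo_scal g (C / a) (1 - 0) Hg.
apply: (ex_RInt0oo_le (V := R_CompleteNormedModule) _ (fun t => C / a * g t) _ _ _ _ HF).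
- by move=> t t0; apply: continuous_gamma_weight.
- move=> t t0; apply: (continuous_scal_r (V := R_NormedModule)); exact: cg.
- move=> t t0; rewrite /norm /= /abs /= Rabs_pos_eq; last exact/Rlt_le/gamma_weight_gt0.
  rewrite (_ : C / a * g t = exp ((a - 1) * ln t) * (C * exp (- (a + 1) * ln (1 + t)))).
    by apply: Rmult_le_compat_l; [exact/Rlt_le/exp_pos|apply: HC; lra].
  rewrite (_ : exp (- (a + 1) * ln (1 + t)) = exp (- a * ln (1 + t)) * / (1 + t)); last first.
    rewrite -{3}(exp_ln (1 + t)); last lra.
    by rewrite -exp_Ropp -exp_plus; congr exp; ring.
  rewrite (_ : exp ((a - 1) * ln t) = exp (a * ln t) * / t); last first.
    rewrite -{3}(exp_ln t); last lra.
    by rewrite -exp_Ropp -exp_plus; congr exp; ring.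
  rewrite /g /F (_ : a * (ln t - ln (1 + t)) = a * ln t + - a * ln (1 + t)); last by ring.
  by rewrite exp_plus; field; lra.
Qed.

Definition Rgamma (a : R) : R := RInt_gen (gamma_weight a) (at_right 0) (Rbar_locally p_infty).

Lemma is_RInt0oo_RInt_gen {V : CompleteNormedModule R_AbsRing} (f : R -> V) l :
  is_RInt0oo f l -> is_RInt0oo f (RInt_gen f (at_right 0) (Rbar_locally p_infty)).
Proof. by move=> H; rewrite (is_RInt_gen_unique _ _ H). Qed.

Lemma is_RInt0oo_Rgamma a : 0 < a -> is_RInt0oo (gamma_weight a) (Rgamma a).
Proof. by move=> /ex_gamma_weight [l Hl]; apply: is_RInt0oo_RInt_gen Hl. Qed.

Lemma gamma_weight_lim0 a : 1 < a -> filterlim (gamma_weight a) (at_right 0) (locally 0).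
Proof.
move=> a1; apply: filterlim_at_right0 => eps e0.
exists (exp (ln eps / (a - 1))); split=> [|t [t0 ht]]; first exact: exp_pos.
rewrite Rminus_0_r Rabs_pos_eq; last exact/Rlt_le/gamma_weight_gt0.
rewrite /gamma_weight -exp_plus -(exp_ln eps) //; apply: exp_increasing.
have h1 : ln t < ln eps / (a - 1) by rewrite -(ln_exp (ln eps / (a - 1))); apply: ln_increasing.
have h3 : (a - 1) * ln t < ln eps; last lra.
rewrite (_ : ln eps = (a - 1) * (ln eps / (a - 1))); last by field; lra.
by apply: Rmult_lt_compat_l; lra.
Qed.

Lemma gamma_weight_lim_oo a : 1 < a ->
  filterlim (gamma_weight a) (Rbar_locally p_infty) (locally 0).
Proof.
move=> a1; have [C [C0 HC]] := exp_opp_bound a (ltac:(lra)).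
apply: filterlim_p_infty => eps e0; exists (C / eps) => t ht.
have ce : 0 < C / eps by apply: Rdiv_lt_0_compat.
rewrite Rminus_0_r Rabs_pos_eq; last exact/Rlt_le/gamma_weight_gt0.
have h1 : gamma_weight a t <= C * exp (- ln (1 + t)).
  apply: (Rle_trans _ (exp ((a - 1) * ln (1 + t)) * (C * exp (- a * ln (1 + t))))).
    apply: Rmult_le_compat; try exact/Rlt_le/exp_pos; last by apply: HC; lra.
    apply: exp_incr; apply: Rmult_le_compat_l; first lra.
    by apply/Rlt_le/ln_increasing; lra.
  by rewrite Rmult_comm Rmult_assoc -exp_plus; apply/Req_le; congr (_ * exp _); ring.
apply: Rle_lt_trans h1 _; rewrite exp_Ropp exp_ln; last lra.
apply: (Rmult_lt_reg_r (1 + t)); first lra; rewrite Rmult_assoc Rinv_l; last lra.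
have := Rmult_lt_compat_r _ _ _ e0 ht; rewrite /Rdiv Rmult_assoc Rinv_l; nra.
Qed.

(** Two exponents, because factors such as ln t are unbounded at both ends: t^d absorbs them at
    infinity and t^(-d) at 0. *)
Lemma ex_RInt0oo_gamma_weight (f : R -> C) M a b : 0 < a -> 0 < b ->
  (forall t, 0 < t -> continuous (U := C_UniformSpace) f t) ->
  (forall t, 0 < t -> Cmod (f t) <= M * (gamma_weight a t + gamma_weight b t)) ->
  exists l, is_RInt0oo (V := C_R_NormedModule) f l.
Proof.
move=> a0 b0 cf fM.
have H := is_RInt0oo_scal _ M _ (is_RInt0oo_plus _ _ _ _ (is_RInt0oo_Rgamma a a0) (is_RInt0oo_Rgamma b b0)).
apply: (ex_RInt0oo_le (V := C_R_CompleteNormedModule) _ _ _ cf _ _ H).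
- move=> t t0; apply: (continuous_scal_r (V := R_NormedModule)).
  by apply: (continuous_plus (V := R_NormedModule)); apply: continuous_gamma_weight.
- by move=> t t0; apply: Rle_trans (fM t t0); rewrite norm_C; apply: Rle_refl.
Qed.

Lemma Cmod_RInt0oo_le (f : R -> C) g lf lg :
  (forall t, 0 < t -> Cmod (f t) <= g t) ->
  is_RInt0oo (V := C_R_NormedModule) f lf -> is_RInt0oo g lg -> Cmod lf <= lg.
Proof.
move=> fg Hf Hg; rewrite -norm_C.
apply: (is_RInt0oo_le (V := C_R_CompleteNormedModule) _ _ _ _ _ Hf Hg) => t t0.
by apply: Rle_trans (fg t t0); rewrite norm_C; apply: Rle_refl.
Qed.

(** This is |u| <= e^u + e^(-u) at u = d ln t. *)
Lemma Rabs_ln_le d t : 0 < d -> Rabs (ln t) <= / d * (exp (d * ln t) + exp (- d * ln t)).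
Proof.
move=> d0; have h1 := exp_ineq1_le (d * ln t); have h2 := exp_ineq1_le (- d * ln t).
have p1 := exp_pos (d * ln t); have p2 := exp_pos (- d * ln t).
apply: (Rmult_le_reg_l d) => //; rewrite -Rmult_assoc Rinv_r; last lra.
by rewrite Rmult_1_l -{1}(Rabs_pos_eq d); [rewrite -Rabs_mult; apply: Rabs_le; lra|lra].
Qed.

(** The integral lives in a real normed module, whose own scaling covers only real factors. *)
Lemma is_RInt_Cmult_l (c : C) (f : R -> C) a b l :
  is_RInt (V := C_R_NormedModule) f a b l ->
  is_RInt (V := C_R_NormedModule) (fun t => (c * f t)%C) a b (c * l)%C.
Proof.
move=> H.
have hr : is_RInt (fun t => Re (f t)) a b (Re l) by apply: is_RInt_fct_extend_fst H.
have hi : is_RInt (fun t => Im (f t)) a b (Im l) by apply: is_RInt_fct_extend_snd H.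
apply: is_RInt_C.
- exact: (is_RInt_minus _ _ _ _ _ _ (is_RInt_scal _ _ _ (Re c) _ hr) (is_RInt_scal _ _ _ (Im c) _ hi)).
- exact: (is_RInt_plus _ _ _ _ _ _ (is_RInt_scal _ _ _ (Re c) _ hi) (is_RInt_scal _ _ _ (Im c) _ hr)).
Qed.

Lemma is_RInt0oo_Cmult_l (c : C) (f : R -> C) l :
  is_RInt0oo (V := C_R_NormedModule) f l ->
  is_RInt0oo (V := C_R_NormedModule) (fun t => (c * f t)%C) (c * l)%C.
Proof.
move=> H P HP.
have HQ : locally (T := C_UniformSpace) l (fun y => P (c * y)%C).
  exact: (filterlim_scal_r (K := C_AbsRing) (V := C_NormedModule) c l P HP).
move: (H _ HQ); rewrite /filtermapi; apply: filter_imp => -[a b] /= [y [Hy Py]].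
by exists (c * y)%C; split=> //; apply: is_RInt_Cmult_l.
Qed.

Definition gamma_fun (z : C) (t : R) : C := (Cexp ((z - 1) * ln t) * exp (- t))%C.

Lemma Re_sub1_mul (z : C) (u : R) : Re ((z - 1) * u)%C = (Re z - 1) * u.
Proof. by rewrite re_scal_r. Qed.

Lemma Cmod_gamma_fun z t : Cmod (gamma_fun z t) = gamma_weight (Re z) t.
Proof.
rewrite /gamma_fun Cmod_mult Cmod_Cexp Re_sub1_mul Cmod_R Rabs_pos_eq //.
exact/Rlt_le/exp_pos.
Qed.

Lemma continuous_gamma_fun z t : 0 < t -> continuous (U := C_UniformSpace) (gamma_fun z) t.
Proof.
move=> t0; apply: continuous_Cmult; first exact: continuous_Cexp_ln.
exact/continuous_RtoC/continuous_exp_opp.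
Qed.

Lemma is_RInt0oo_CGamma z : 0 < Re z ->
  is_RInt0oo (V := C_R_NormedModule) (gamma_fun z) (CGamma z).
Proof.
move=> z0.
have [l Hl] : exists l, is_RInt0oo (V := C_R_NormedModule) (gamma_fun z) l.
  apply: (ex_RInt0oo_gamma_weight _ 1 _ _ z0 z0) => t t0; first exact: continuous_gamma_fun.
  by rewrite Cmod_gamma_fun; have := gamma_weight_gt0 (Re z) t; lra.
exact: (is_RInt0oo_RInt_gen (V := C_R_CompleteNormedModule) _ _ Hl).
Qed.

(** * Differentiation of Gamma under the integral sign *)

Definition CGamma' (z : C) : C :=
  RInt_gen (V := C_R_CompleteNormedModule) (fun t : R => (gamma_fun z t * ln t)%C)
    (at_right 0) (Rbar_locally p_infty).

Lemma continuous_gamma_fun_ln z t :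
  0 < t -> continuous (U := C_UniformSpace) (fun t : R => (gamma_fun z t * ln t)%C) t.
Proof.
move=> t0; apply: continuous_Cmult; first exact: continuous_gamma_fun.
exact/continuous_RtoC/continuous_ln.
Qed.

Lemma is_RInt0oo_CGamma' z : 0 < Re z ->
  is_RInt0oo (V := C_R_NormedModule) (fun t : R => (gamma_fun z t * ln t)%C) (CGamma' z).
Proof.
move=> z0; pose d := Re z / 2.
have [l Hl] : exists l, is_RInt0oo (V := C_R_NormedModule) (fun t : R => (gamma_fun z t * ln t)%C) l.
  apply: (ex_RInt0oo_gamma_weight _ (/ d) (Re z + d) (Re z + - d)); rewrite /d; try lra.
    by move=> t t0; apply: continuous_gamma_fun_ln.
  move=> t t0; rewrite Cmod_mult Cmod_gamma_fun Cmod_R -!gamma_weight_mul -/d.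
  have := Rabs_ln_le d t (ltac:(rewrite /d; lra)).
  have := gamma_weight_gt0 (Re z) t; nra.
exact: (is_RInt0oo_RInt_gen (V := C_R_CompleteNormedModule) _ _ Hl).
Qed.

Lemma gamma_fun_add z w t : gamma_fun (z + w) t = (gamma_fun z t * Cexp (w * ln t))%C.
Proof.
rewrite /gamma_fun (_ : (z + w - 1) * ln t = (z - 1) * ln t + w * ln t)%C; last by ring.
by rewrite Cexp_add; ring.
Qed.

(** The integrand of the remainder is t^(z-1) e^(-t) (t^h - 1 - h ln t), of modulus at most |h|^2
    (ln t)^2 (2 + t^(Re h)) times the weight. The factor in t is bounded by powers t^(3d) and
    t^(-3d), uniformly in |h| <= d. *)
Lemma CGamma_taylor z : 0 < Re z ->
  exists M d, 0 < d /\ forall h, Cmod h <= d ->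
    Cmod (CGamma (z + h) - CGamma z - h * CGamma' z) <= M * Cmod h ^ 2.
Proof.
(* With 3 d = Re z / 2 both exponents Re z + 3 d and Re z - 3 d stay positive. *)
move=> z0; pose d := Re z / 6; have d0 : 0 < d by rewrite /d; lra.
have [a0 b0] : 0 < Re z + 3 * d /\ 0 < Re z + - (3 * d) by rewrite /d; lra.
exists (8 / d ^ 2 * (Rgamma (Re z + 3 * d) + Rgamma (Re z + - (3 * d)))), d.
split=> // h Hh.
have rh : Rabs (Re h) <= d by apply: Rle_trans (re_le_Cmod h) _.
have zh0 : 0 < Re (z + h)%C.
  have -> : Re (z + h)%C = Re z + Re h by [].
  by have [h1 h2] := proj1 (Rabs_le_between _ _) rh; rewrite /d in h1; lra.
have HI := is_RInt0oo_plus (V := C_R_NormedModule) _ _ _ _ (is_RInt0oo_CGamma _ zh0)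
  (is_RInt0oo_plus (V := C_R_NormedModule) _ _ _ _
     (is_RInt0oo_Cmult_l (Copp 1) _ _ (is_RInt0oo_CGamma _ z0))
     (is_RInt0oo_Cmult_l (- h)%C _ _ (is_RInt0oo_CGamma' _ z0))).
have HG := is_RInt0oo_scal _ (8 / d ^ 2 * Cmod h ^ 2) _
  (is_RInt0oo_plus _ _ _ _ (is_RInt0oo_Rgamma _ a0) (is_RInt0oo_Rgamma _ b0)).
rewrite (_ : (_ - _ - _)%C = plus (G := C_R_NormedModule) (CGamma (z + h)) (plus (G := C_R_NormedModule) (Copp 1 * CGamma z)%C (- h * CGamma' z)%C)); last first.
  by rewrite /plus /=; change (CGamma (z + h) - CGamma z - h * CGamma' z = CGamma (z + h) + (Copp 1 * CGamma z + - h * CGamma' z))%C; ring.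
apply: Rle_trans (Cmod_RInt0oo_le _ _ _ _ _ HI HG) _; last first.
  by apply/Req_le; rewrite /scal /= /mult /= /plus /=; ring.
move=> t t0; lazy beta.
change (Cmod (gamma_fun (z + h) t + (Copp 1 * gamma_fun z t + - h * (gamma_fun z t * ln t))) <=
  8 / d ^ 2 * Cmod h ^ 2 * (gamma_weight (Re z + 3 * d) t + gamma_weight (Re z + - (3 * d)) t)).
rewrite (_ : (gamma_fun (z + h) t + _)%C = (gamma_fun z t * (Cexp (h * ln t) - 1 - h * ln t))%C); last first.
  by rewrite gamma_fun_add; ring.
rewrite Cmod_mult Cmod_gamma_fun -!gamma_weight_mul.
have := Cmod_Cexp_sub1_sub (h * ln t)%C.
rewrite Cmod_mult Cmod_R re_scal_r.
set W := gamma_weight _ _; have W0 : 0 < W by apply: gamma_weight_gt0.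
set e := exp (d * ln t); set e' := exp (- d * ln t).
have ee : e * e' = 1 by rewrite /e /e' -exp_plus -exp_0; congr exp; ring.
have [e0 e'0] : 0 < e /\ 0 < e' by split; apply: exp_pos.
have E3 : exp (3 * d * ln t) = e ^ 3 by rewrite /e /= Rmult_1_r -!exp_plus; congr exp; ring.
have E3' : exp (- (3 * d) * ln t) = e' ^ 3 by rewrite /e' /= Rmult_1_r -!exp_plus; congr exp; ring.
have hl : Rabs (ln t) <= / d * (e + e') by apply: Rabs_ln_le.
have hr : exp (Re h * ln t) <= e + e'.
  have [h1 h2] := proj1 (Rabs_le_between _ _) rh.
  case: (Rle_dec 0 (ln t)) => hl0.
    have : exp (Re h * ln t) <= e by apply: exp_incr; nra.
    lra.
  have : exp (Re h * ln t) <= e' by apply: exp_incr; nra.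
  lra.
rewrite E3 E3' => H.
(* With [A] = t^d + t^(-d) >= 2, the two logarithms give (A / d)^2 and 2 + t^(Re h) <= 2 A. Then A^3
   <= 4 (t^(3d) + t^(-3d)) yields the constant 8 / d^2. *)
set A := e + e' in hl hr.
have sq : 0 <= (e - e') * (e - e') by apply: Rle_0_sqr.
have A2 : 2 <= A by apply: Rnot_lt_le => hlt; rewrite /A in hlt; nra.
have hA : A * A * A <= 4 * (e ^ 3 + e' ^ 3).
  have : 0 <= (e + e') * ((e - e') * (e - e')) by nra.
  rewrite /A /=; lra.
have hln2 : Rabs (ln t) * Rabs (ln t) <= / d * A * (/ d * A).
  by apply: Rmult_le_compat => //; apply: Rabs_pos.
have id0 : 0 < / d by apply: Rinv_0_lt_compat.
have H2 : (Cmod h * Rabs (ln t)) ^ 2 * (2 + exp (Re h * ln t)) <= Cmod h ^ 2 * (8 * (/ d * / d) * (e ^ 3 + e' ^ 3)).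
  rewrite Rpow_mult_distr Rmult_assoc; apply: Rmult_le_compat_l; first exact: pow2_ge_0.
  apply: (Rle_trans _ ((/ d * A * (/ d * A)) * (A + A))).
    apply: Rmult_le_compat; [exact: pow2_ge_0| |rewrite /= Rmult_1_r //|lra].
    by have := exp_pos (Re h * ln t); lra.
  have : / d * / d * (A * A * A) <= / d * / d * (4 * (e ^ 3 + e' ^ 3)) by apply: Rmult_le_compat_l; nra.
  lra.
apply: (Rle_trans _ (W * (Cmod h ^ 2 * (8 * (/ d * / d) * (e ^ 3 + e' ^ 3))))).
  by apply: Rmult_le_compat_l; [lra|apply: Rle_trans H2].
apply/Req_le; rewrite /Rdiv /=; field; lra.
Qed.

Lemma is_derive_of_taylor (f : C -> C) (z l : C) (M d : R) :
  0 < d -> (forall h, Cmod h <= d -> Cmod (f (z + h)%C - f z - h * l) <= M * Cmod h ^ 2) ->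
  is_derive (K := C_AbsRing) (V := C_NormedModule) f z l.
Proof.
move=> d0 H; split; first exact: is_linear_scal_l.
move=> x Hx; have -> : x = z by apply/esym/(is_filter_lim_locally_unique (V := AbsRing_NormedModule C_AbsRing)).
move=> eps.
(* No sign of [M] is assumed; [Rabs M + 1] is a positive bound for it. *)
have M0 : 0 < Rabs M + 1 by have := Rabs_pos M; lra.
pose r := Rmin d (eps / (Rabs M + 1)).
have r0 : 0 < r by apply: Rmin_pos => //; apply: Rdiv_lt_0_compat => //; apply: cond_pos.
apply: (locally_le_locally_norm (V := AbsRing_NormedModule C_AbsRing)).
exists (mkposreal _ r0) => y Hy.
have {}Hy : Cmod (y - z) < r by exact: Hy.
change (Cmod (f y - f z - (y - z) * l) <= eps * Cmod (y - z)).
have hd := Rmin_l d (eps / (Rabs M + 1)); have he := Rmin_r d (eps / (Rabs M + 1)); rewrite -/r in hd he.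
have := H (y - z)%C (ltac:(lra)).
rewrite (_ : (z + (y - z))%C = y); last by ring.
set h := Cmod (y - z) in Hy *; have h0 : 0 <= h by apply: Cmod_ge_0.
have hM := Rle_abs M.
have e1 : h * (Rabs M + 1) <= eps.
  apply: Rle_trans (Rmult_le_compat_r _ _ (eps / (Rabs M + 1)) _ _) _; try lra.
  by apply/Req_le; field; lra.
move=> h2; apply: (Rle_trans _ _ _ h2); simpl.
nra.
Qed.

Lemma is_derive_CGamma z : 0 < Re z ->
  is_derive (K := C_AbsRing) (V := C_NormedModule) CGamma z (CGamma' z).
Proof. by move=> /CGamma_taylor [M [d [d0 H]]]; apply: is_derive_of_taylor d0 H. Qed.

Lemma digamma_E z : 0 < Re z -> digamma z = (CGamma' z / CGamma z)%C.
Proof.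
by move=> z0; rewrite /digamma (is_C_derive_unique _ _ (CGamma' z)) //; apply: is_derive_CGamma.
Qed.



(** * Functional equations of Gamma and of its derivative *)

Lemma gamma_fun_add1 z t : 0 < t -> gamma_fun (z + 1) t = (t * gamma_fun z t)%C.
Proof.
move=> t0; rewrite /gamma_fun (_ : z + 1 - 1 = z)%C; last by ring.
by rewrite Cexp_ln_add1 //; ring.
Qed.

Lemma Cmod_Cexp_ln_weight (z : C) t rho :
  Cmod (Cexp (z * ln t) * (exp (- t) * rho)%R) = gamma_weight (Re z + 1) t * Rabs rho.
Proof.
rewrite Cmod_mult Cmod_Cexp re_scal_r Cmod_R Rabs_mult (Rabs_pos_eq (exp _)).
  by rewrite /gamma_weight -Rmult_assoc; congr (exp (_ * _) * _ * _); ring.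
exact/Rlt_le/exp_pos.
Qed.

Lemma at_right0_pos : at_right 0 (fun t => 0 < t).
Proof. by exists (mkposreal 1 Rlt_0_1). Qed.

Lemma p_infty_pos : Rbar_locally p_infty (fun t => 0 < t).
Proof. by exists 0. Qed.

Lemma filterlim_scal0 (F : (R -> Prop) -> Prop) {FF : Filter F} (f : R -> R) k :
  filterlim f F (locally 0) -> filterlim (fun t => k * f t) F (locally 0).
Proof.
move=> H; rewrite -[X in locally X](Rmult_0_r k).
apply: (filterlim_comp _ _ _ f (Rmult k) _ (locally 0)) => //.
exact: (filterlim_scal_r (V := R_NormedModule) k 0).
Qed.

Lemma filterlim_plus0 (F : (R -> Prop) -> Prop) {FF : Filter F} (f g : R -> R) :
  filterlim f F (locally 0) -> filterlim g F (locally 0) ->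
  filterlim (fun t => f t + g t) F (locally 0).
Proof.
move=> Hf Hg; rewrite -[X in locally X](Rplus_0_r 0).
apply: (filterlim_comp_2 f g Rplus (G := locally 0) (H := locally 0)) => //.
exact: (filterlim_plus (V := R_NormedModule) 0 0).
Qed.

(** Integration by parts on the half-line: [r] dominates the boundary term t^z rho(t) and vanishes
    at both ends, so the total derivative integrates to 0. *)
Lemma is_RInt0oo_Cexp_ln (z : C) (rho rho' r : R -> R) :
  (forall t, 0 < t -> is_derive rho t (rho' t)) -> (forall t, 0 < t -> continuous rho' t) ->
  (forall t, 0 < t -> Cmod (Cexp (z * ln t) * rho t) <= r t) ->
  filterlim r (at_right 0) (locally 0) -> filterlim r (Rbar_locally p_infty) (locally 0) ->
  is_RInt0oo (V := C_R_NormedModule)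
    (fun t => (Cexp ((z - 1) * ln t) * (z * rho t + t * rho' t))%C) (RtoC 0).
Proof.
move=> dr cr Hr r0 roo.
rewrite (_ : RtoC 0 = minus (G := C_R_NormedModule) (RtoC 0) (RtoC 0)); last first.
  by rewrite minus_eq_zero.
apply: (is_RInt0oo_primitive (V := C_R_CompleteNormedModule) (fun t => Cexp (z * ln t) * rho t)%C).
- by move=> a b a0 ab; apply: is_RInt_Cexp_ln.
- move=> t t0; apply: continuous_Cmult; first exact: continuous_Cexp_ln.
  have crho : continuous rho t.
    by apply: (ex_derive_continuous (V := R_NormedModule)); exists (rho' t); apply: dr.
  apply: continuous_Cplus; apply: continuous_Cmult.
  - exact: continuous_const.
  - exact: continuous_RtoC.
  - by apply: continuous_RtoC; apply: continuous_id.
  - by apply: continuous_RtoC; apply: cr.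
- apply: filterlim_Cmod r0; apply: filter_imp at_right0_pos => t; exact: Hr.
- apply: filterlim_Cmod roo; apply: filter_imp p_infty_pos => t; exact: Hr.
Qed.

Lemma CGamma_add1 z : 0 < Re z -> CGamma (z + 1) = (z * CGamma z)%C.
Proof.
move=> z0.
have H : is_RInt0oo (V := C_R_NormedModule)
    (fun t : R => (Cexp ((z - 1) * ln t) * (z * exp (- t) + t * (- exp (- t))%R))%C) (RtoC 0).
  apply: (is_RInt0oo_Cexp_ln z (fun t => exp (- t)) (fun t => - exp (- t)) (gamma_weight (Re z + 1))).
  - by move=> t t0; auto_derive => //; ring.
  - by move=> t t0; apply: (ex_derive_continuous (V := R_NormedModule)); auto_derive.
  - move=> t t0; rewrite -(Rmult_1_r (exp (- t))) Cmod_Cexp_ln_weight Rabs_R1 Rmult_1_r.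
    exact: Rle_refl.
  - by apply: gamma_weight_lim0; lra.
  - by apply: gamma_weight_lim_oo; lra.
have z1 : 0 < Re (z + 1)%C by have -> : Re (z + 1)%C = Re z + 1 by []; lra.
have H2 := is_RInt0oo_plus (V := C_R_NormedModule) _ _ _ _ H (is_RInt0oo_CGamma _ z1).
apply: (is_RInt0oo_unique (V := C_R_CompleteNormedModule)); last exact: is_RInt0oo_Cmult_l (is_RInt0oo_CGamma _ z0).
rewrite -[X in is_RInt0oo _ X](plus_zero_l (G := C_R_NormedModule)).
apply: (is_RInt0oo_ext _ _ _ _ H2) => t t0.
rewrite gamma_fun_add1 //.
change (Cexp ((z - 1) * ln t) * (z * exp (- t) + t * (- exp (- t))%R) + t * gamma_fun z t =
  z * gamma_fun z t)%C.
by rewrite /gamma_fun RtoC_opp; ring.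
Qed.

Lemma CGamma'_add1 z : 0 < Re z -> CGamma' (z + 1) = (CGamma z + z * CGamma' z)%C.
Proof.
move=> z0; pose d := Re z / 2.
have d0 : 0 < d by rewrite /d; lra.
have H : is_RInt0oo (V := C_R_NormedModule)
    (fun t : R => (Cexp ((z - 1) * ln t) * (z * (exp (- t) * ln t)%R +
       t * (exp (- t) * / t - exp (- t) * ln t)%R))%C) (RtoC 0).
  (* The logarithm is absorbed by [Rabs_ln_le]; with d = Re z / 2 both exponents Re z + 1 + d and Re
     z + 1 - d exceed 1, so the weights vanish at 0. *)
  apply: (is_RInt0oo_Cexp_ln z (fun t => exp (- t) * ln t) (fun t => exp (- t) * / t - exp (- t) * ln t)
    (fun t => / d * (gamma_weight (Re z + 1 + d) t + gamma_weight (Re z + 1 + - d) t))).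
  - by move=> t t0; auto_derive => //; ring.
  - move=> t t0; apply: (ex_derive_continuous (V := R_NormedModule)); auto_derive.
    by repeat split => //; lra.
  - move=> t t0; rewrite Cmod_Cexp_ln_weight -(gamma_weight_mul _ d) -(gamma_weight_mul _ (- d)).
    have := Rabs_ln_le _ t d0; have := gamma_weight_gt0 (Re z + 1) t; nra.
  - by apply: filterlim_scal0; apply: filterlim_plus0; apply: gamma_weight_lim0; rewrite /d; lra.
  - by apply: filterlim_scal0; apply: filterlim_plus0; apply: gamma_weight_lim_oo; rewrite /d; lra.
have z1 : 0 < Re (z + 1)%C by have -> : Re (z + 1)%C = Re z + 1 by []; lra.
have H2 := is_RInt0oo_plus (V := C_R_NormedModule) _ _ _ _ H (is_RInt0oo_CGamma' _ z1).
apply: (is_RInt0oo_unique (V := C_R_CompleteNormedModule)); last first.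
  exact: (is_RInt0oo_plus (V := C_R_NormedModule) _ _ _ _ (is_RInt0oo_CGamma _ z0)
    (is_RInt0oo_Cmult_l z _ _ (is_RInt0oo_CGamma' _ z0))).
rewrite -[X in is_RInt0oo _ X](plus_zero_l (G := C_R_NormedModule)).
apply: (is_RInt0oo_ext _ _ _ _ H2) => t t0.
rewrite gamma_fun_add1 //.
change (Cexp ((z - 1) * ln t) * (z * (exp (- t) * ln t)%R + t * (exp (- t) * / t - exp (- t) * ln t)%R)
  + t * gamma_fun z t * ln t = gamma_fun z t + z * (gamma_fun z t * ln t))%C.
rewrite /gamma_fun RtoC_minus !RtoC_mult RtoC_inv; last lra.
field.
by move=> /(f_equal fst) /=; lra.
Qed.

(** * Concentration of the Gamma measures *)

Lemma exp_mul_ln_INR n t : 0 < t -> exp (INR n * ln t) = t ^ n.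
Proof. by move=> t0; rewrite -Rpower_pow. Qed.

Lemma gamma_weight_INR n t : 0 < t -> gamma_weight (INR n + 1) t = t ^ n * exp (- t).
Proof.
move=> t0; rewrite /gamma_weight (_ : INR n + 1 - 1 = INR n); last by ring.
by rewrite exp_mul_ln_INR.
Qed.

(** Makes all polynomial moments explicit. The induction adds the integral of the derivative of -
    t^(n+1) e^(-t), which is 0. *)
Lemma is_RInt0oo_fact n : is_RInt0oo (fun t => t ^ n * exp (- t)) (INR (fact n)).
Proof.
have cw m t : continuous (fun t => t ^ m * exp (- t)) t.
  by apply: (ex_derive_continuous (V := R_NormedModule)); auto_derive.
elim: n => [|n IH].
  rewrite (_ : INR (fact 0) = 0 - -1); last by rewrite /=; ring.
  apply: (is_RInt0oo_ext (fun t => exp (- t))) => [t _|]; first by rewrite /= Rmult_1_l.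
  apply: (is_RInt0oo_derive (fun t => - exp (- t))).
  - by move=> t _; auto_derive => //; ring.
  - by move=> t _; apply: continuous_exp_opp.
  - apply: filterlim_at_right0 => eps e0; exists eps; split=> // t Ht.
    have := exp_ineq1_le (- t); have : exp (- t) < exp 0 by apply: exp_increasing; lra.
    by rewrite exp_0 => h1 h2; apply: Rabs_def1; lra.
  - apply: filterlim_p_infty => eps e0; exists (- ln eps) => t Ht.
    have := exp_pos (- t); have : exp (- t) < exp (ln eps) by apply: exp_increasing; lra.
    by rewrite exp_ln // => h1 h2; apply: Rabs_def1; lra.
have Sn : 1 < INR n.+1 + 1 by have := lt_0_INR n.+1 (Nat.lt_0_succ n); lra.
have Hf : is_RInt0oo (fun t => t ^ n.+1 * exp (- t) - INR n.+1 * (t ^ n * exp (- t))) (0 - 0).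
  apply: (is_RInt0oo_derive (fun t => - (t ^ n.+1 * exp (- t)))).
  - move=> t _; auto_derive => //; rewrite -/(INR n.+1) S_INR /=; ring.
  - move=> t _; apply: (continuous_minus (V := R_NormedModule)); first exact: cw.
    by apply: (continuous_scal_r (V := R_NormedModule)); apply: cw.
  - apply: (filterlim_ext_loc (fun t => -1 * gamma_weight (INR n.+1 + 1) t)).
      by apply: filter_imp at_right0_pos => t t0; rewrite gamma_weight_INR //; ring.
    by apply: filterlim_scal0; apply: gamma_weight_lim0.
  - apply: (filterlim_ext_loc (fun t => -1 * gamma_weight (INR n.+1 + 1) t)).
      by apply: filter_imp p_infty_pos => t t0; rewrite gamma_weight_INR //; ring.
    by apply: filterlim_scal0; apply: gamma_weight_lim_oo.
have H := is_RInt0oo_plus _ _ _ _ Hf (is_RInt0oo_scal _ (INR n.+1) _ IH).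
rewrite fact_simpl mult_INR -[X in is_RInt0oo _ X]Rplus_0_l -{1}(Rminus_0_r 0).
by apply: is_RInt0oo_ext H => t _; rewrite /plus /scal /= /mult /=; ring.
Qed.

(* With N = n + 1 and s = t / N, the integrand is t^N e^(-t) f(s) / s; the division by s makes room
   for the singularity of ln s at 0. *)
Definition has_moments (f : R -> R) (c : R) : Prop :=
  exists v : nat -> R, is_lim_seq v c /\ forall n,
    is_RInt0oo (fun t => INR n.+1 * (t ^ n * exp (- t)) * f (t / INR n.+1))
      (INR (fact n.+1) * v n).

Lemma INR_S_gt0 n : 0 < INR n.+1.
Proof. exact: lt_0_INR (Nat.lt_0_succ n). Qed.

Lemma has_moments_ext f g c : (forall s, f s = g s) -> has_moments f c -> has_moments g c.
Proof.
move=> fg [v [vc Hv]]; exists v; split=> // n.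
by apply: is_RInt0oo_ext (Hv n) => t _; rewrite fg.
Qed.

Lemma has_moments_plus f g c d :
  has_moments f c -> has_moments g d -> has_moments (fun s => f s + g s) (c + d).
Proof.
move=> [v [vc Hv]] [w [wd Hw]]; exists (fun n => v n + w n); split.
  exact: is_lim_seq_plus'.
move=> n; rewrite Rmult_plus_distr_l.
apply: is_RInt0oo_ext (is_RInt0oo_plus _ _ _ _ (Hv n) (Hw n)) => t _.
by rewrite /plus /=; ring.
Qed.

Lemma has_moments_scal f c k : has_moments f c -> has_moments (fun s => k * f s) (k * c).
Proof.
move=> [v [vc Hv]]; exists (fun n => k * v n); split.
  exact: (is_lim_seq_scal_l v k c).
move=> n; rewrite (_ : _ * (k * v n) = k * (INR (fact n.+1) * v n)); last by ring.
apply: is_RInt0oo_ext (is_RInt0oo_scal _ k _ (Hv n)) => t _.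
by rewrite /scal /= /mult /=; ring.
Qed.

Lemma is_lim_seq_inv_S : is_lim_seq (fun n => / INR n.+1) 0.
Proof.
apply/(is_lim_seq_incr_1 (fun n => / INR n)).
by apply: (is_lim_seq_inv _ p_infty) => //; apply: is_lim_seq_INR.
Qed.

(** The normalised moment is (n + j)! / (n! (n + 1)^j), and passing from j to j + 1 multiplies it by
    1 + j / (n + 1). By linearity the limit for a polynomial is its value at s = 1. *)
Lemma has_moments_pow j : has_moments (fun s => s ^ j) 1.
Proof.
exists (fun n => INR (fact (n + j)) / (INR (fact n) * INR n.+1 ^ j)); split.
  elim: j => [|j IH].
    apply: (is_lim_seq_ext (fun=> 1)); last exact: is_lim_seq_const.
    by move=> n; rewrite addn0 /=; field; apply: INR_fact_neq_0.
  have L : is_lim_seq (fun n => 1 + INR j * / INR n.+1) 1.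
    rewrite (_ : Finite 1 = Finite (1 + INR j * 0)); last by congr Finite; ring.
    apply: is_lim_seq_plus'; first exact: is_lim_seq_const.
    apply: (is_lim_seq_scal_l _ (INR j) 0).
    exact: is_lim_seq_inv_S.
  have := is_lim_seq_mult' _ _ _ _ IH L; rewrite Rmult_1_r.
  apply: is_lim_seq_ext => n.
  have h1 := INR_fact_neq_0 n; have h2 := INR_S_gt0 n.
  rewrite addnS fact_simpl mult_INR -addSn plus_INR -tech_pow_Rmult.
  field; repeat split => //; try lra.
  by apply: pow_nonzero; lra.
move=> n; have h2 := INR_S_gt0 n.
have h1 := INR_fact_neq_0 n.
have hp : INR n.+1 ^ j <> 0 by apply: pow_nonzero; lra.
rewrite (_ : _ * _ = INR n.+1 / INR n.+1 ^ j * INR (fact (n + j))); last first.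
  by rewrite fact_simpl mult_INR; field.
apply: is_RInt0oo_ext (is_RInt0oo_scal _ (INR n.+1 / INR n.+1 ^ j) _ (is_RInt0oo_fact (n + j))) => t _.
rewrite /scal /= /mult /= /Rdiv Rpow_mult_distr pow_add pow_inv.
by field.
Qed.

Lemma Rabs_le_AMGM d u : 0 < d -> Rabs u <= d / 2 * 1 + / (2 * d) * (u * u).
Proof.
move=> d0; have <- : Rabs u * Rabs u = u * u by rewrite -Rabs_mult Rabs_pos_eq //; exact: Rle_0_sqr.
have := Rle_0_sqr (Rabs u - d); rewrite /Rsqr => h.
apply: (Rmult_le_reg_l (2 * d)); first lra.
rewrite (_ : 2 * d * (_ + _) = d * d + Rabs u * Rabs u); [lra|field; lra].
Qed.

(** The weight anticipates [CGamma_asymptotics]: 1 + s comes from |ln s| <= |s - 1| (1 + s) / s, and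
    2 + s^k dominates 1 + s^(Re z). As |s - 1| is no polynomial, it is bounded by d / 2 + (s - 1)^2
    / (2 d) for every d > 0, whose moments are known. *)
Lemma gamma_concentration k : exists W : nat -> R, is_lim_seq W 0 /\ forall n,
  is_RInt0oo (fun t => INR n.+1 * (t ^ n * exp (- t)) *
      (Rabs (t / INR n.+1 - 1) * ((1 + t / INR n.+1) * (2 + (t / INR n.+1) ^ k))))
    (INR (fact n.+1) * W n).
Proof.
have [v1 [L1 H1]] : has_moments (fun s => (1 + s) * (2 + s ^ k)) 6.
  (* The limits 6 here and 0 below are the values at s = 1 of the two polynomials, split into
     monomials. *)
  rewrite (_ : 6 = 2 * 1 + 2 * 1 + (1 + 1)); last by ring.
  apply: (has_moments_ext (fun s => 2 * s ^ 0 + 2 * s ^ 1 + (s ^ k + s ^ (k.+1)))).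
    by move=> s /=; ring.
  by repeat first [apply: has_moments_plus | apply: has_moments_scal | apply: has_moments_pow].
have [v2 [L2 H2]] : has_moments (fun s => (s - 1) * (s - 1) * ((1 + s) * (2 + s ^ k))) 0.
  rewrite (_ : 0 = 2 * 1 + -2 * 1 + -2 * 1 + 2 * 1 + (1 + -1 * 1 + -1 * 1 + 1)); last by ring.
  apply: (has_moments_ext (fun s => 2 * s ^ 0 + -2 * s ^ 1 + -2 * s ^ 2 + 2 * s ^ 3 +
      (s ^ k + -1 * s ^ (k.+1) + -1 * s ^ (k.+2) + s ^ (k.+3)))).
    by move=> s /=; ring.
  by repeat first [apply: has_moments_plus | apply: has_moments_scal | apply: has_moments_pow].
pose f n t := INR n.+1 * (t ^ n * exp (- t)) *
      (Rabs (t / INR n.+1 - 1) * ((1 + t / INR n.+1) * (2 + (t / INR n.+1) ^ k))).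
pose g d n t := INR n.+1 * (t ^ n * exp (- t)) *
      ((d / 2 * 1 + / (2 * d) * ((t / INR n.+1 - 1) * (t / INR n.+1 - 1))) *
       ((1 + t / INR n.+1) * (2 + (t / INR n.+1) ^ k))).
have Hg d n : 0 < d -> is_RInt0oo (g d n) (INR (fact n.+1) * (d / 2 * v1 n + / (2 * d) * v2 n)).
  move=> d0.
  have := is_RInt0oo_plus _ _ _ _ (is_RInt0oo_scal _ (d / 2) _ (H1 n)) (is_RInt0oo_scal _ (/ (2 * d)) _ (H2 n)).
  rewrite (_ : plus _ _ = INR (fact n.+1) * (d / 2 * v1 n + / (2 * d) * v2 n)); last first.
    by rewrite /plus /scal /= /mult /=; ring.
  by apply: is_RInt0oo_ext => t _; rewrite /g /plus /scal /= /mult /=; ring.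
have c0 n t : 0 < t -> 0 <= INR n.+1 * (t ^ n * exp (- t)) /\ 0 <= (1 + t / INR n.+1) * (2 + (t / INR n.+1) ^ k).
  move=> t0; have h := INR_S_gt0 n.
  have s0 : 0 < t / INR n.+1 by apply: Rdiv_lt_0_compat.
  split; last by have := pow_lt _ k s0; nra.
  by apply: Rmult_le_pos; [lra|apply: Rmult_le_pos; [apply: pow_le; lra|apply/Rlt_le/exp_pos]].
have fg d n t : 0 < d -> 0 < t -> 0 <= f n t <= g d n t.
  move=> d0 t0; have [h1 h2] := c0 n t t0; split.
    by apply: Rmult_le_pos => //; apply: Rmult_le_pos => //; apply: Rabs_pos.
  apply: Rmult_le_compat_l => //; apply: Rmult_le_compat_r => //; exact: Rabs_le_AMGM.
have cR (h : R -> R) t : ex_derive h t -> continuous h t.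
  exact: (ex_derive_continuous (V := R_NormedModule)).
have cf n t : 0 < t -> continuous (f n) t.
  move=> t0; have hn := INR_S_gt0 n.
  apply: (continuous_mult (K := R_AbsRing) (fun t => INR n.+1 * (t ^ n * exp (- t)))).
    by apply: cR; auto_derive.
  apply: (continuous_mult (K := R_AbsRing) (fun t => Rabs (t / INR n.+1 - 1))).
    apply: (continuous_comp (fun t => t / INR n.+1 - 1) Rabs); last exact: continuous_Rabs.
    by apply: cR; auto_derive.
  by apply: cR; auto_derive.
have cg d n t : 0 < t -> continuous (g d n) t.
  by move=> t0; apply: cR; rewrite /g; auto_derive.
pose W n := RInt_gen (f n) (at_right 0) (Rbar_locally p_infty) / INR (fact n.+1).
have HW n : is_RInt0oo (f n) (INR (fact n.+1) * W n).
  have [w Hw] : exists w, is_RInt0oo (f n) w.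
    apply: (ex_RInt0oo_le (V := R_CompleteNormedModule) _ _ _ (cf n) (cg 1 n) _ (Hg 1 n Rlt_0_1)).
    move=> t t0; have [h1 h2] := fg 1 n t Rlt_0_1 t0.
    by rewrite /norm /= /abs /= Rabs_pos_eq.
  rewrite (_ : _ * _ = RInt_gen (f n) (at_right 0) (Rbar_locally p_infty)).
    exact: is_RInt0oo_RInt_gen Hw.
  by rewrite /W; field; apply: INR_fact_neq_0.
exists W; split=> //.
have F0 n : 0 < INR (fact n.+1) by apply: INR_fact_lt_0.
have Wle d n : 0 < d -> W n <= d / 2 * v1 n + / (2 * d) * v2 n.
  move=> d0; apply: (Rmult_le_reg_l _ _ _ (F0 n)); apply: Rle_trans (Rle_abs _) _.
  apply: (is_RInt0oo_le (V := R_CompleteNormedModule) _ _ _ _ _ (HW n) (Hg d n d0)) => t t0.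
  have [h1 h2] := fg d n t d0 t0.
  by rewrite /norm /= /abs /= Rabs_pos_eq.
have W0 n : 0 <= W n.
  apply: (Rmult_le_reg_l _ _ _ (F0 n)); rewrite Rmult_0_r.
  have h0 : is_RInt0oo (fun _ : R => 0) 0.
    rewrite -[X in is_RInt0oo _ X](Rmult_0_l (INR (fact n.+1) * W n)).
    apply: is_RInt0oo_ext (is_RInt0oo_scal _ 0 _ (HW n)) => t _; exact: Rmult_0_l.
  apply: Rle_trans (Rabs_pos 0) _.
  apply: (is_RInt0oo_le (V := R_CompleteNormedModule) _ _ _ _ _ h0 (HW n)) => t t0.
  by have [h1 _] := fg 1 n t Rlt_0_1 t0; rewrite /norm /= /abs /= Rabs_R0.
apply/is_lim_seq_spec => eps; have e0 := cond_pos eps.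
(* Eventually v1 < 7 and v2 < eps d, so each of the two terms is below eps / 2. *)
pose d := eps / 7; have d0 : 0 < d by rewrite /d; lra.
have ed0 : 0 < eps * d by apply: Rmult_lt_0_compat.
have /is_lim_seq_spec /(_ (mkposreal 1 Rlt_0_1)) E1 := L1.
have /is_lim_seq_spec /(_ (mkposreal _ ed0)) E2 := L2.
apply: filter_imp (filter_and _ _ E1 E2) => n /= [/Rabs_def2 h1 /Rabs_def2 h2].
rewrite Rminus_0_r Rabs_pos_eq //.
apply: Rle_lt_trans (Wle d n d0) _.
have k1 : d / 2 * v1 n < eps / 2 by rewrite /d; nra.
have k2 : / (2 * d) * v2 n < eps / 2; last lra.
apply: (Rmult_lt_reg_l (2 * d)); first lra.
by rewrite -Rmult_assoc Rinv_r; lra.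
Qed.

(** * Asymptotics of the digamma function *)

Lemma is_RInt0oo_RtoC (f : R -> R) l :
  is_RInt0oo f l -> is_RInt0oo (V := C_R_NormedModule) (fun t => RtoC (f t)) (RtoC l).
Proof.
move=> H P HP.
have HQ : locally l (fun y => P (RtoC y)).
  exact: (continuous_RtoC (fun y => y) l (continuous_id l) P HP).
move: (H _ HQ); rewrite /filtermapi; apply: filter_imp => -[a b] /= [y [Hy Py]].
exists (RtoC y); split=> //; apply: is_RInt_C => //=.
have := is_RInt_const (V := R_NormedModule) a b 0.
by rewrite /scal /= /mult /= Rmult_0_r.
Qed.

(** From 1 - 1 / s <= ln s <= s - 1. *)
Lemma Rabs_ln_le_sub1 s : 0 < s -> Rabs (ln s) <= Rabs (s - 1) * (1 + / s).
Proof.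
move=> s0; have h1 := exp_ineq1_le (ln s); have h2 := exp_ineq1_le (- ln s).
rewrite exp_Ropp exp_ln // in h2; rewrite exp_ln // in h1.
have i0 : 0 < / s by apply: Rinv_0_lt_compat.
have is1 : s * / s = 1 by apply: Rinv_r; lra.
have := Rle_abs (s - 1); have := Rle_abs (- (s - 1)); rewrite Rabs_Ropp => k1 k2.
have k0 := Rabs_pos (s - 1).
by apply: Rabs_le; split; nra.
Qed.

Lemma exp_mul_ln_le (x s : R) k : 0 < s -> 0 <= x <= INR k -> exp (x * ln s) <= 1 + s ^ k.
Proof.
move=> s0 Hx; rewrite -exp_mul_ln_INR //.
have p := exp_pos (INR k * ln s).
case: (Rle_dec 0 (ln s)) => hl.
  have : exp (x * ln s) <= exp (INR k * ln s) by apply: exp_incr; nra.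
  lra.
have : exp (x * ln s) <= exp 0 by apply: exp_incr; nra.
by rewrite exp_0; lra.
Qed.

(** The scaling s = t / N is carried out on the integrand with t kept as variable, which avoids a
    substitution in the improper integral. *)
Lemma gamma_fun_rescale z n t : 0 < t ->
  gamma_fun (z + INR n.+1 + 1) t =
  (Cexp (z * ln (INR n.+1)) * ((t ^ n.+1 * exp (- t))%R * Cexp (z * ln (t / INR n.+1))))%C.
Proof.
move=> t0; have hn := INR_S_gt0 n.
rewrite /gamma_fun ln_div //.
rewrite (_ : ((z + INR n.+1 + 1 - 1) * ln t =
   RtoC (INR n.+1 * ln t) + (z * ln (INR n.+1) + z * (ln t - ln (INR n.+1))%R))%C); last first.
  by rewrite RtoC_minus RtoC_mult; ring.
by rewrite !Cexp_add Cexp_RtoC exp_mul_ln_INR // RtoC_mult; ring.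
Qed.

(** With N = n + 1, [D] = N^z N! is what remains of Gamma(z + N + 1) when s^z is replaced by 1. For
    the derivative, ln t - ln N = ln s is small where the mass sits. *)
Lemma CGamma_asymptotics z : 0 < Re z ->
  exists W : nat -> R, is_lim_seq W 0 /\ forall n,
    let D := (Cexp (z * ln (INR n.+1)) * INR (fact n.+1))%C in
    let w := (z + INR n.+1 + 1)%C in
    Cmod (CGamma w - D) <= Cmod D * W n /\
    Cmod (CGamma' w - ln (INR n.+1) * CGamma w) <= Cmod D * W n.
Proof.
move=> z0; have [k Hk] := INR_unbounded (Re z).
have [W [W0 HW]] := gamma_concentration k.
(* |z| serves the first estimate, through |s^z - 1| <= |z| |ln s| (1 + s^(Re z)), and 1 the
   second. *)
pose M := 1 + Cmod z; have M0 := Cmod_ge_0 z.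
exists (fun n => M * W n); split.
  by rewrite -(Rmult_0_r M); apply: (is_lim_seq_scal_l W M 0).
move=> n D w; have N0 := INR_S_gt0 n; pose E := Cexp (z * ln (INR n.+1)).
have w0 : 0 < Re w by rewrite /w; have -> : Re (z + INR n.+1 + 1)%C = Re z + INR n.+1 + 1 by []; lra.
have F0 : 0 < INR (fact n.+1) by apply: INR_fact_lt_0.
have DE : Cmod D = Cmod E * INR (fact n.+1).
  by rewrite /D Cmod_mult Cmod_R Rabs_pos_eq //; lra.
have E0 := Cmod_ge_0 E.
have HM := is_RInt0oo_scal _ (Cmod E * M) _ (HW n).
have -> : Cmod D * (M * W n) = scal (Cmod E * M) (INR (fact n.+1) * W n).
  by rewrite DE /scal /= /mult /=; ring.
(* The exponent drops from N to n because t^N (1 + 1 / s) = N t^n (1 + s). *)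
have wgt t : 0 < t -> let s := t / INR n.+1 in 0 < s /\
    t ^ n.+1 * exp (- t) * (Rabs (ln s) * (1 + exp (Re z * ln s))) <=
    INR n.+1 * (t ^ n * exp (- t)) * (Rabs (s - 1) * ((1 + s) * (2 + s ^ k))).
  move=> t0 s; have s0 : 0 < s by apply: Rdiv_lt_0_compat.
  split=> //.
  have -> : INR n.+1 * (t ^ n * exp (- t)) * (Rabs (s - 1) * ((1 + s) * (2 + s ^ k))) =
      t ^ n.+1 * exp (- t) * ((Rabs (s - 1) * (1 + / s)) * (2 + s ^ k)).
    rewrite -tech_pow_Rmult; move: (s ^ k) => p; rewrite /s; field; lra.
  apply: Rmult_le_compat_l.
    by apply: Rmult_le_pos; [apply: pow_le; lra|apply/Rlt_le/exp_pos].
  apply: Rmult_le_compat; [exact: Rabs_pos| |exact: Rabs_ln_le_sub1|].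
    by have := exp_pos (Re z * ln s); lra.
  by have := exp_mul_ln_le (Re z) s k s0 (ltac:(lra)); lra.
have te t : 0 < t -> 0 <= t ^ n.+1 * exp (- t).
  by move=> t0; apply: Rmult_le_pos; [apply: pow_le; lra|apply/Rlt_le/exp_pos].
split.
- have Hc := is_RInt0oo_fact n.+1.
  have Hc' : is_RInt0oo (V := C_R_NormedModule) (fun t => RtoC (t ^ n.+1 * exp (- t))) (RtoC (INR (fact n.+1))).
    exact: is_RInt0oo_RtoC.
  have HI := is_RInt0oo_plus (V := C_R_NormedModule) _ _ _ _ (is_RInt0oo_CGamma _ w0)
    (is_RInt0oo_Cmult_l (- E)%C _ _ Hc').
  have -> : (CGamma w - D)%C = plus (G := C_R_NormedModule) (CGamma w) (- E * INR (fact n.+1))%C.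
    by change (CGamma w - D = CGamma w + - E * INR (fact n.+1))%C; rewrite /D /E; ring.
  apply: (Cmod_RInt0oo_le _ _ _ _ _ HI HM) => t t0.
  change (Cmod (gamma_fun w t + - E * (t ^ n.+1 * exp (- t))%R) <= (Cmod E * M) * (INR n.+1 * (t ^ n * exp (- t)) *
      (Rabs (t / INR n.+1 - 1) * ((1 + t / INR n.+1) * (2 + (t / INR n.+1) ^ k))))).
  have [s0 hs] := wgt t t0; move: s0 hs; set s := t / INR n.+1 => s0 hs.
  rewrite /w gamma_fun_rescale // -/E -/s.
  rewrite (_ : (_ + _)%C = (E * ((t ^ n.+1 * exp (- t))%R * (Cexp (z * ln s) - 1)))%C); last by ring.
  rewrite !Cmod_mult Cmod_R Rabs_pos_eq; last exact: te.
  have := Cmod_Cexp_sub1 (z * ln s)%C; rewrite Cmod_mult Cmod_R re_scal_r => hc.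
  rewrite (Rmult_assoc (Cmod E) M); apply: Rmult_le_compat_l => //.
  apply: (Rle_trans _ (t ^ n.+1 * exp (- t) * (Cmod z * (Rabs (ln s) * (1 + exp (Re z * ln s)))))).
    by apply: Rmult_le_compat_l; [exact: te|lra].
  rewrite (_ : _ * (Cmod z * _) = Cmod z * (t ^ n.+1 * exp (- t) * (Rabs (ln s) * (1 + exp (Re z * ln s))))); last by ring.
  apply: Rmult_le_compat => //; last by rewrite /M; lra.
  apply: Rmult_le_pos; first exact: te.
  by apply: Rmult_le_pos; [exact: Rabs_pos|have := exp_pos (Re z * ln s); lra].
- have HI := is_RInt0oo_plus (V := C_R_NormedModule) _ _ _ _ (is_RInt0oo_CGamma' _ w0)
    (is_RInt0oo_Cmult_l (- ln (INR n.+1))%C _ _ (is_RInt0oo_CGamma _ w0)).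
  have -> : (CGamma' w - ln (INR n.+1) * CGamma w)%C = plus (G := C_R_NormedModule) (CGamma' w) (- ln (INR n.+1) * CGamma w)%C.
    by change (CGamma' w - ln (INR n.+1) * CGamma w = CGamma' w + - ln (INR n.+1) * CGamma w)%C; ring.
  apply: (Cmod_RInt0oo_le _ _ _ _ _ HI HM) => t t0.
  change (Cmod (gamma_fun w t * ln t + - ln (INR n.+1) * gamma_fun w t) <= (Cmod E * M) * (INR n.+1 * (t ^ n * exp (- t)) *
      (Rabs (t / INR n.+1 - 1) * ((1 + t / INR n.+1) * (2 + (t / INR n.+1) ^ k))))).
  have [s0 hs] := wgt t t0; move: s0 hs.
  have lns : ln (t / INR n.+1) = ln t - ln (INR n.+1) by apply: ln_div.
  rewrite (_ : (_ + _)%C = (gamma_fun w t * ln (t / INR n.+1))%C); last by rewrite lns RtoC_minus; ring.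
  set s := t / INR n.+1 => s0 hs.
  rewrite /w gamma_fun_rescale // -/E -/s !Cmod_mult !Cmod_R (Rabs_pos_eq (t ^ _ * _)); last exact: te.
  rewrite Cmod_Cexp re_scal_r.
  rewrite (Rmult_assoc (Cmod E) M) (Rmult_assoc (Cmod E)); apply: Rmult_le_compat_l => //.
  have p := exp_pos (Re z * ln s); have q := te t t0; have r := Rabs_pos (ln s).
  have qr : 0 <= t ^ n.+1 * exp (- t) * Rabs (ln s) by apply: Rmult_le_pos.
  apply: (Rle_trans _ _ _ _ (Rle_trans _ _ _ hs _)); first by nra.
  set Q := _ * (Rabs (s - 1) * _) in hs *.
  have : 0 <= Q by apply: Rle_trans hs; apply: Rmult_le_pos => //; apply: Rmult_le_pos; lra.
  by rewrite /M; nra.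
Qed.

Lemma CGamma_digamma_limit z : 0 < Re z ->
  exists W : nat -> R, is_lim_seq W 0 /\ exists N, forall n, (N <= n)%coq_nat ->
    let w := (z + INR n.+1 + 1)%C in
    CGamma w <> RtoC 0 /\ Cmod (CGamma' w / CGamma w - ln (INR n.+1)) <= W n.
Proof.
move=> /CGamma_asymptotics [W [W0 HW]].
exists (fun n => 2 * W n); split.
  by rewrite -(Rmult_0_r 2); apply: (is_lim_seq_scal_l W 2 0).
(* Once W n < 1 / 2, |Gamma(w)| >= |D| / 2: this gives nonvanishing and the factor 2 in the new
   bound. *)
have /is_lim_seq_spec /(_ (mkposreal (/ 2) (ltac:(lra)))) [N HN] := W0.
exists N => n /HN /Rabs_def2 [h1 h2] w; rewrite /= in h1 h2.
have [k1 k2] := HW n; move: k1 k2; rewrite -/w; set D := (Cexp _ * _)%C => k1 k2.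
have D0 : 0 < Cmod D.
  rewrite Cmod_mult Cmod_Cexp Cmod_R; apply: Rmult_lt_0_compat; first exact: exp_pos.
  by apply: Rabs_pos_lt; apply: INR_fact_neq_0.
have G0 : Cmod D / 2 <= Cmod (CGamma w).
  have := Cmod_triangle (CGamma w) (- (CGamma w - D)); rewrite Cmod_opp.
  rewrite (_ : (CGamma w + - (CGamma w - D))%C = D); last by ring.
  by nra.
have Gn0 : CGamma w <> RtoC 0 by move=> h; move: G0; rewrite h Cmod_0; lra.
split=> //.
rewrite (_ : (_ - _)%C = ((CGamma' w - ln (INR n.+1) * CGamma w) / CGamma w)%C); last by field.
rewrite Cmod_div //; apply: (Rmult_le_reg_r (Cmod (CGamma w))); first lra.
rewrite /Rdiv Rmult_assoc Rinv_l; last lra.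
have W0n : 0 <= W n by have := Cmod_ge_0 (CGamma w - D); nra.
by nra.
Qed.

Lemma Re_add_INR (z : C) n : Re (z + INR n)%C = Re z + INR n.
Proof. by []. Qed.

(** By the functional equation a zero at z would recur at every z + n, against the asymptotics. *)
Lemma CGamma_neq0 z : 0 < Re z -> CGamma z <> RtoC 0.
Proof.
move=> z0 G0; have [W [_ [N HN]]] := CGamma_digamma_limit z z0.
have [Hn _] := HN N (le_n N); apply: Hn.
have H n : CGamma (z + INR n) = RtoC 0.
  elim: n => [|n IH]; first by rewrite Cplus_0_r.
  rewrite (_ : z + INR n.+1 = z + INR n + 1)%C; last by rewrite S_INR RtoC_plus; ring.
  rewrite CGamma_add1; first by rewrite IH Cmult_0_r.
  by rewrite Re_add_INR; have := pos_INR n; lra.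
by have := H N.+2; rewrite (S_INR N.+1) RtoC_plus Cplus_assoc.
Qed.

Lemma Cneq0_Re (z : C) : 0 < Re z -> z <> RtoC 0.
Proof. by move=> z0 h; rewrite h /= in z0; lra. Qed.

Lemma digamma_add1 z : 0 < Re z -> digamma (z + 1) = (digamma z + 1 / z)%C.
Proof.
move=> z0; have z1 : 0 < Re (z + 1)%C by have -> : Re (z + 1)%C = Re z + 1 by []; lra.
rewrite !digamma_E // CGamma_add1 // CGamma'_add1 //.
by have h1 := CGamma_neq0 z z0; have h2 := Cneq0_Re z z0; field; split.
Qed.

Lemma digamma_sub_ln_limit z : 0 < Re z ->
  is_lim_seq (fun n => Cmod (digamma (z + 1 + INR n.+1) - ln (INR n.+1))) 0.
Proof.
move=> z0; have [W [W0 [N HN]]] := CGamma_digamma_limit z z0.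
apply: (is_lim_seq_le_le_loc (fun=> 0) _ W) => //; last exact: is_lim_seq_const.
exists N => n /HN [_ h]; split; first exact: Cmod_ge_0.
rewrite (_ : z + 1 + INR n.+1 = z + INR n.+1 + 1)%C; last by ring.
rewrite digamma_E //.
rewrite (_ : Re _ = Re z + INR n.+1 + 1) //; have := INR_S_gt0 n; lra.
Qed.

(** * The numbers p_1(m) *)

(* prod_(k < m) (k - x), the Pochhammer symbol (-x)_m *)
Fixpoint npoch (x : R) (m : nat) : R :=
  if m is n.+1 then npoch x n * (INR n - x) else 1.

Lemma npochS x m : npoch x m.+1 = npoch x m * (INR m - x).
Proof. by []. Qed.

(** [I_m] of the overview; it equals (-1)^m m! G_m, with G_m the Gregory coefficient, the integral
    of binomial(x, m) over [0, 1]. *)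
Definition npoch_int (m : nat) : R := RInt (npoch^~ m) 0 1.

Lemma ex_derive_npoch m x : ex_derive (npoch^~ m) x.
Proof.
elim: m => [|m IH] /=; first exact: ex_derive_const.
apply: (ex_derive_mult (npoch^~ m) (fun x => INR m - x)) => //.
by auto_derive.
Qed.

Lemma continuous_npoch m x : continuous (npoch^~ m) x.
Proof. by apply: (ex_derive_continuous (V := R_NormedModule)); apply: ex_derive_npoch. Qed.

Lemma is_RInt_npoch m : is_RInt (npoch^~ m) 0 1 (npoch_int m).
Proof.
apply: (RInt_correct (V := R_CompleteNormedModule)).
by apply: ex_RInt_continuous => z _; apply: continuous_npoch.
Qed.

Lemma is_derive_horner (p : {poly R}) (x : R) :
  is_derive (fun x : R => p.[x]%ring) x (p^`().[x])%ring.
Proof.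
elim/poly_ind: p => [|p c IH].
  rewrite deriv0 horner0; apply: (is_derive_ext (fun=> 0)) => [t|]; first by rewrite horner0.
  exact: is_derive_const.
apply: (is_derive_ext (fun x : R => p.[x]%ring * x + c)); first by move=> t; rewrite !hornerE.
have -> : ((p * 'X + c%:P)^`().[x] = p.[x] + x * p^`().[x])%ring.
  by rewrite derivD derivM derivX derivC GRing.addr0 GRing.mulr1 hornerD hornerM hornerX GRing.addrC (GRing.mulrC x).
have ex : ex_derive (fun x : R => p.[x]%ring) x by eexists; exact: IH.
auto_derive; first exact: ex.
rewrite (is_derive_unique _ _ _ IH).
change (1 * (p^`()).[x]%ring * x + p.[x]%ring * 1 = p.[x]%ring + x * (p^`()).[x]%ring); ring.
Qed.

Lemma is_RInt_big_sum n (f : nat -> R -> R) (l : nat -> R) a b :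
  (forall i, is_RInt (f i) a b (l i)) ->
  is_RInt (fun x => \sum_(i < n) f i x)%ring a b (\sum_(i < n) l i)%ring.
Proof.
move=> H; elim: n => [|n IH].
  rewrite big_ord0; apply: (is_RInt_ext (fun=> 0)) => [x _|]; first by rewrite big_ord0.
  have := is_RInt_const (V := R_NormedModule) a b 0.
  by rewrite /scal /= /mult /= Rmult_0_r.
rewrite big_ord_recr; have := is_RInt_plus _ _ _ _ _ _ IH (H n).
by apply: is_RInt_ext => x _; rewrite big_ord_recr.
Qed.

Lemma is_RInt_sum_pow n (c : nat -> R) :
  is_RInt (fun x : R => \sum_(i < n) c i * x ^+ i)%ring 0 1
    (\sum_(i < n) c i / (i.+1)%:R)%ring.
Proof.
apply: (is_RInt_big_sum n (fun i x => (c i * x ^+ i)%ring) (fun i => (c i / (i.+1)%:R)%ring)) => i.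
apply: (is_RInt_ext (fun x => scal (c i) (x ^ i))); first by move=> x _; rewrite RpowE.
apply: is_RInt_scal; rewrite -INRE.
have -> : (INR i.+1)^-1%ring = minus (1 ^ i.+1 / INR i.+1) (0 ^ i.+1 / INR i.+1).
  rewrite /minus /plus /opp /= pow1 Rmult_0_l /Rdiv Rmult_0_l Ropp_0 Rplus_0_r Rmult_1_l Rmult_1_l.
  by rewrite RinvE.
have hn := INR_S_gt0 i.
apply: (is_RInt_derive (fun x => x ^ i.+1 / INR i.+1)) => x _.
  by auto_derive => //; rewrite -/(INR i.+1); move: (INR i.+1) hn => N hn; field; lra.
by apply: (ex_derive_continuous (V := R_NormedModule)); auto_derive.
Qed.

Definition falling (m : nat) : {poly R} := (\prod_(i < m) ('X - (i%:R)%:P))%ring.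

Lemma size_falling m : size (falling m) = m.+1.
Proof. by rewrite /falling size_prod_XsubC /index_enum -enumT size_enum_ord. Qed.

Lemma npochE x m : npoch x m = ((-1) ^+ m * (falling m).[x])%ring.
Proof.
elim: m => [|m IH]; first by rewrite /falling big_ord0 !hornerE.
rewrite /falling big_ord_recr /= -/(falling m) hornerM hornerXsubC IH GRing.exprS INRE.
change ((((-1) ^+ m * (falling m).[x]) * (m%:R - x)) = (-1 * (-1) ^+ m * ((falling m).[x] * (x - m%:R))))%ring.
set a := (_ ^+ m)%ring; set b := (_.[x])%ring; set c : R := (m%:R)%ring.
change (a * b * (c - x) = -1 * a * (b * (x - c))); ring.
Qed.

Lemma sum_n_m_big (f : nat -> R) n m : (n <= m)%nat ->
  sum_n_m f n m = (\sum_(n <= k < m.+1) f k)%ring.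
Proof.
move=> /subnK <-; elim: (m - n)%nat => [|d IH]; first by rewrite sum_n_n big_nat1.
rewrite addSn sum_n_Sm; last by apply/leP; rewrite -addSn leq_addl.
by rewrite IH [RHS]big_nat_recr // -addSn leq_addl.
Qed.

Lemma horner_falling (m : nat) (x : R) : (falling m).[x]%ring = (\sum_(i < m.+1) (stirling1 m i) * x ^+ i)%ring.
Proof. by rewrite horner_coef size_falling. Qed.

Lemma falling_root m (k : nat) : (k < m)%nat -> ((falling m).[k%:R])%ring = 0.
Proof.
move=> km; rewrite /falling horner_prod (bigD1 (Ordinal km)) //= !hornerE.
by rewrite GRing.subrr GRing.mul0r.
Qed.

Lemma npoch_intE m : npoch_int m = ((-1) ^+ m * \sum_(i < m.+1) stirling1 m i / (i.+1)%:R)%ring.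
Proof.
apply: is_RInt_unique; pose a : R := ((-1) ^+ m)%ring.
have H := is_RInt_scal _ _ _ a _ (is_RInt_sum_pow m.+1 (stirling1 m)).
apply: is_RInt_ext H => x _.
by rewrite npochE horner_falling.
Qed.

(** The weight is k! (k - 1) / (k + 1)! = 1 - 2 / (k + 1). The part with 1 sums to the falling
    factorial at 1, which is 0; the part with 2 / (k + 1) is an integral of monomials over
    [0, 1]. *)
Lemma p1E m : INR m.+2 * p1 m.+2 = - npoch_int m.+2.
Proof.
set M := m.+2; have M0 : INR M <> 0 by apply: not_0_INR.
have S0 : stirling1 M 0 = 0.
  have : ((falling M).[0%:R])%ring = 0 by apply: falling_root.
  rewrite horner_falling big_ord_recl big1 /=; last by move=> i _; rewrite GRing.mulrC GRing.exprS !GRing.mul0r.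
  by rewrite GRing.expr0 GRing.mulr1 GRing.addr0.
have S1 : (\sum_(i < M.+1) stirling1 M i)%ring = 0.
  have <- : ((falling M).[1%:R])%ring = 0 by exact: (falling_root M (S O)).
  rewrite horner_falling.
  by apply: eq_bigr => i _; rewrite GRing.expr1n GRing.mulr1.
have E : sum_n_m (fun k : nat => INR k`! * (INR k - 1) / INR (k.+1)`! * stirling1 M k) 2 M =
   -2 * (\sum_(i < M.+1) stirling1 M i / (i.+1)%:R)%ring.
  transitivity ((\sum_(i < M.+1) stirling1 M i)%ring - 2 * (\sum_(i < M.+1) stirling1 M i / (i.+1)%:R)%ring); last first.
    by rewrite S1; move: (\sum_(i < _) _)%ring => s; change (0 - 2 * s = -2 * s); ring.
  rewrite sum_n_m_big //.
  transitivity (\sum_(i < M.+1) (stirling1 M i - 2 * (stirling1 M i / (i.+1)%:R)))%ring; last first.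
    by rewrite GRing.sumrB -GRing.mulr_sumr.
  rewrite -(big_mkord xpredT (fun i => stirling1 M i - 2 * (stirling1 M i / (i.+1)%:R)))%ring.
  rewrite [RHS](@big_cat_nat _ _ _ 2) //= [X in _ = (X + _)%ring]big_nat_recr // big_nat1 /= S0.
  (* The sum may start at 0 instead of 2: the term k = 0 vanishes with S_m(0), the term k = 1
     because 1 - 2 / 2 = 0. *)
  have -> : (0 - 2 * (0 / 1%:R) + (stirling1 M 1 - 2 * (stirling1 M 1 / 2%:R)))%ring = 0.
    by rewrite GRing.mul0r GRing.mulr0 GRing.subrr GRing.add0r GRing.mulrCA GRing.divff ?GRing.mulr1 ?GRing.subrr // Num.Theory.pnatr_eq0.
  rewrite GRing.add0r; apply: eq_bigr => k _.
  rewrite -(INRE k.+1); change (INR k`! * (INR k - 1) / INR (k.+1)`! * stirling1 M k =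
    stirling1 M k - 2 * (stirling1 M k / INR k.+1)).
  have h1 : INR k`! <> 0 by rewrite -factE; apply: INR_fact_neq_0.
  have h2 := INR_S_gt0 k.
  rewrite factS mult_INR S_INR; rewrite S_INR in h2; field; split => //; lra.
rewrite /p1 E npoch_intE -RpowE; set s := (\sum_(i < _) _)%ring.
change (INR M * ((-1) ^ M / (2 * INR M) * (-2 * s)) = - ((-1) ^ M * s)); field; exact: M0.
Qed.

(** * The polynomials b_m *)

Definition raising (m : nat) : {poly R} := (\prod_(k < m) ('X + (k%:R)%:P))%ring.

Lemma size_raising m : size (raising m) = m.+1.
Proof.
rewrite /raising (eq_bigr (fun k : 'I_m => 'X - (- (k%:R))%:P)%ring); last first.
  by move=> k _; rewrite polyCN GRing.opprK.
by rewrite size_prod_XsubC /index_enum -enumT size_enum_ord.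
Qed.

Lemma horner_raising m (x : R) :
  ((raising m).[x])%ring = \big[Rmult/1]_(k < m) (INR k + x).
Proof.
rewrite /raising horner_prod; apply: eq_bigr => k _.
by rewrite hornerD hornerX hornerC INRE GRing.addrC.
Qed.

Lemma horner_raising_opp m (u : R) : ((raising m).[- u])%ring = npoch u m.
Proof.
elim: m => [|m IH]; first by rewrite /raising big_ord0 hornerC.
rewrite /raising big_ord_recr /= -/(raising m) hornerM IH hornerD hornerX hornerC INRE.
by rewrite GRing.addrC.
Qed.

(** With x = alpha - u the integrand becomes (1/2 - u) times [raising m] at - u + alpha, u in
    [0, 1]. The divided derivatives at - u are its Taylor coefficients in alpha. *)
Definition bpol_coef (m i : nat) : R :=
  RInt (fun u : R => (/ 2 - u) * ((raising m)^`N(i)).[- u]%ring) 0 1.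

Lemma continuous_horner_opp (p : {poly R}) (u : R) : continuous (fun u : R => p.[- u]%ring) u.
Proof.
apply: (continuous_comp (fun u : R => - u) (fun x : R => p.[x]%ring)).
  exact: (continuous_opp (V := R_NormedModule) _ _ (continuous_id _)).
apply: (ex_derive_continuous (V := R_NormedModule)); eexists; exact: is_derive_horner.
Qed.

Lemma continuous_bpol_coef m i (u : R) :
  continuous (fun u : R => (/ 2 - u) * ((raising m)^`N(i)).[- u]%ring) u.
Proof.
apply: (continuous_mult (K := R_AbsRing) (fun u : R => / 2 - u)); last exact: continuous_horner_opp.
by apply: (ex_derive_continuous (V := R_NormedModule)); auto_derive.
Qed.

Lemma is_RInt_bpol_coef m i :
  is_RInt (fun u : R => (/ 2 - u) * ((raising m)^`N(i)).[- u]%ring) 0 1 (bpol_coef m i).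
Proof.
apply: (RInt_correct (V := R_CompleteNormedModule)).
by apply: ex_RInt_continuous => z _; apply: continuous_bpol_coef.
Qed.

Definition bpoly (m : nat) : {poly R} :=
  ((INR m)^-1 *: \poly_(i < size (raising m)) bpol_coef m i)%ring.

Lemma bpolE m alpha : bpol m alpha = (bpoly m).[alpha]%ring.
Proof.
rewrite /bpol /bpoly hornerZ horner_poly; congr (_ * _).
set f := fun x : R => _; apply: is_RInt_unique.
have H := is_RInt_big_sum (size (raising m))
  (fun i u => scal (alpha ^ i) ((/ 2 - u) * ((raising m)^`N(i)).[- u]%ring))
  (fun i => scal (alpha ^ i) (bpol_coef m i)) 0 1
  (fun i => is_RInt_scal _ _ _ _ _ (is_RInt_bpol_coef m i)).
have {}H : is_RInt (fun u => f (- u + alpha)) 0 1 (\sum_(i < size (raising m)) bpol_coef m i * alpha ^+ i)%ring.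
  have -> : (\sum_(i < size (raising m)) bpol_coef m i * alpha ^+ i)%ring =
      (\sum_(i < size (raising m)) scal (pow alpha i) (bpol_coef m i))%ring.
    by apply: eq_bigr => i _; rewrite GRing.mulrC -RpowE.
  apply: is_RInt_ext H => u _; rewrite /f.
  have -> : - u + alpha + / 2 - alpha = / 2 - u by ring.
  rewrite -horner_raising.
  have -> : ((raising m).[- u + alpha])%ring = (\sum_(i < size (raising m)) ((raising m)^`N(i)).[- u] * alpha ^+ i)%ring.
    by apply: nderiv_taylor; apply: GRing.mulrC.
  have -> : (/ 2 - u) * (\sum_(i < size (raising m)) ((raising m)^`N(i)).[- u] * alpha ^+ i)%ring =
      (\sum_(i < size (raising m)) (/ 2 - u)%R * (((raising m)^`N(i)).[- u] * alpha ^+ i))%ring.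
    exact: GRing.mulr_sumr.
  apply: eq_bigr => i _.
  rewrite -RpowE; set A := (_.[_])%ring.
  change (alpha ^ i * ((/ 2 - u) * A) = (/ 2 - u) * (A * alpha ^ i)); ring.
(* The substitution u = alpha - x reverses the orientation; the swap of the bounds and the opposite
   compensate. *)
have := is_RInt_comp_lin (fun u => f (- u + alpha)) (-1) alpha (alpha - 1) alpha.
rewrite (_ : -1 * (alpha - 1) + alpha = 1) 1?(_ : -1 * alpha + alpha = 0); try ring.
move=> /(_ _ (is_RInt_swap _ _ _ _ H)) /(is_RInt_opp) H2.
rewrite -[X in is_RInt _ _ _ X](opp_opp).
apply: is_RInt_ext H2 => x _.
rewrite /opp /scal /= /mult /= (_ : - (-1 * x + alpha) + alpha = x); ring.
Qed.

(** Integration by parts: the derivative of - (1/2 - u) (-u)_m is the integrand plus (-u)_m, and for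
    m >= 2 the boundary terms vanish because 0 and 1 are roots of (-u)_m. *)
Lemma bpol_coef1 m : bpol_coef m.+2 1 = - npoch_int m.+2.
Proof.
set M := m.+2; apply: is_RInt_unique.
have dF (u : R) : is_derive (fun u : R => - ((/ 2 - u) * (raising M).[(- u)%R]%ring)) u
    ((/ 2 - u) * ((raising M)^`()).[(- u)%R]%ring + npoch u M).
  have D := is_derive_horner (raising M) (- u).
  have ex : ex_derive (fun x : R => (raising M).[x]%ring) (- u) by eexists; exact: D.
  auto_derive; first exact: ex.
  by rewrite (is_derive_unique _ _ _ D) -horner_raising_opp; set A := (_.[_])%ring; set B := (_.[_])%ring; ring.
have r0 : npoch 0 M = 0.
  by rewrite npochE (falling_root M 0) // GRing.mulr0.
have r1 : npoch 1 M = 0.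
  by rewrite npochE (falling_root M (S O)) // GRing.mulr0.
have H : is_RInt (fun u : R => (/ 2 - u) * ((raising M)^`()).[(- u)%R]%ring + npoch u M) 0 1 0.
  rewrite [X in is_RInt _ _ _ X](_ : 0 = minus (- ((/ 2 - 1) * (raising M).[(- 1)%R]%ring)) (- ((/ 2 - 0) * (raising M).[(- 0)%R]%ring))).
    apply: (is_RInt_derive (fun u : R => - ((/ 2 - u) * (raising M).[(- u)%R]%ring))) => u _ //.
    apply: (continuous_plus (V := R_NormedModule)); last exact: continuous_npoch.
    by rewrite -nderivn1; apply: continuous_bpol_coef.
  by rewrite !horner_raising_opp r0 r1 /minus /plus /opp /=; ring.
have := is_RInt_minus _ _ _ _ _ _ H (is_RInt_npoch M).
rewrite (_ : minus 0 (npoch_int M) = - npoch_int M); last exact: Rplus_0_l.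
apply: is_RInt_ext => u _; rewrite nderivn1; set A := (_ * _); set B := npoch u M.
by change (A + B + - B = A); ring.
Qed.

Lemma bpoly_coef1 m : ((bpoly m.+2)`_1)%ring = p1 m.+2.
Proof.
have M0 : INR m.+2 <> 0 by apply: not_0_INR.
rewrite /bpoly coefZ coef_poly.
rewrite size_raising /=.
rewrite bpol_coef1 -p1E.
change (/ INR m.+2 * (INR m.+2 * p1 m.+2) = p1 m.+2); field; exact: M0.
Qed.

(** * The principal logarithm *)

Lemma ln_sqrt_half x : 0 < x -> ln (sqrt x) = / 2 * ln x.
Proof.
move=> x0; have s0 : 0 < sqrt x by apply: sqrt_lt_R0.
rewrite -{2}(sqrt_sqrt x); last lra.
by rewrite ln_mult //; lra.
Qed.

(** Replaces the case split of [Carg] by an expression that can be differentiated along x -> z +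
    x. *)
Lemma Carg_atan (z : C) : 0 < Re z -> Carg z = atan (Im z / Re z).
Proof.
move=> z0; have m0 : 0 < Cmod z by apply/Cmod_gt_0/Cneq0_Re.
have H : acos (Re z / Cmod z) = atan (Rabs (Im z) / Re z).
  have c0 : 0 < Re z / Cmod z by apply: Rdiv_lt_0_compat.
  rewrite acos_atan //; congr atan.
  have -> : 1 - (Re z / Cmod z)² = (Rabs (Im z) / Cmod z)².
    rewrite !Rsqr_div' -Rsqr_abs /Rsqr.
    have := Cmod2_alt z; rewrite /= !Rmult_1_r => h.
    apply: (Rmult_eq_reg_r (Cmod z * Cmod z)); last by nra.
    rewrite Rmult_minus_distr_r; rewrite (_ : Re z * Re z / _ * _ = Re z * Re z); last by field; lra.
    by rewrite (_ : Im z * Im z / _ * _ = Im z * Im z); [lra|field; lra].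
  rewrite sqrt_Rsqr; last by apply: Rdiv_le_0_compat => //; exact: Rabs_pos.
  by field; lra.
rewrite /Carg; case: Rle_dec => hi; rewrite H.
  by rewrite Rabs_pos_eq.
rewrite Rabs_left; last lra.
by rewrite -atan_opp; congr atan; field; lra.
Qed.

(** The segment from z to z + 1 stays in the right half-plane, so the principal branch is a
    primitive there; real and imaginary parts are treated separately. *)
Lemma is_RInt_inv_Clog (z : C) : 0 < Re z ->
  is_RInt (V := C_R_NormedModule) (fun x : R => (/ (z + x))%C) 0 1 (Clog (z + 1) - Clog z)%C.
Proof.
case: z => a b /= a0.
have P x : 0 <= x -> 0 < (a + x) * (a + x) + b * b by nra.
have ClogE x : 0 <= x ->
    Clog ((a, b) + RtoC x)%C = (/ 2 * ln ((a + x) * (a + x) + b * b), atan (b / (a + x))).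
  move=> x0; rewrite /Clog Carg_atan /=; last lra.
  rewrite Rplus_0_r; congr pair.
  by rewrite /Cmod ln_sqrt_half /= !Rmult_1_r Rplus_0_r //; apply: P.
have -> : Clog (a, b) = Clog ((a, b) + RtoC 0)%C by rewrite Cplus_0_r.
rewrite !ClogE; try lra.
have rng x : Rmin 0 1 <= x <= Rmax 0 1 -> 0 <= x by rewrite Rmin_left ?Rmax_right; lra.
apply: is_RInt_C.
- apply: (is_RInt_ext (fun x => (a + x) / ((a + x) * (a + x) + b * b))).
    by move=> x _; rewrite /= !Rmult_1_r Rplus_0_r.
  apply: (is_RInt_derive (fun x => / 2 * ln ((a + x) * (a + x) + b * b))) => x /rng x0; have := P x x0 => Px.
    by auto_derive => //; field; lra.
  by apply: (ex_derive_continuous (V := R_NormedModule)); auto_derive; lra.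
- apply: (is_RInt_ext (fun x => - b / ((a + x) * (a + x) + b * b))).
    by move=> x _; rewrite /= !Rmult_1_r !Rplus_0_r.
  apply: (is_RInt_derive (fun x => atan (b / (a + x)))) => x /rng x0; have := P x x0 => Px.
    by auto_derive; [lra|rewrite /Rsqr; field; split; nra].
  by apply: (ex_derive_continuous (V := R_NormedModule)); auto_derive; lra.
Qed.

Lemma Cmod_le_abs (z : C) : Cmod z <= Rabs (Re z) + Rabs (Im z).
Proof.
case: z => a b; have -> : (a, b) = (RtoC a + Ci * b)%C by rewrite /Ci /Cmult /Cplus /RtoC /=; congr pair; ring.
apply: Rle_trans (Cmod_triangle _ _) _; rewrite Cmod_mult Cmod_Ci !Cmod_R /=.
rewrite (_ : a + _ = a); last by ring.
rewrite (_ : 0 + _ = b); [lra|ring].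
Qed.

Lemma Clog_sub_ln_limit (w : C) : 0 < Re w ->
  is_lim_seq (fun n => Cmod (Clog (w + INR n.+1) - ln (INR n.+1))) 0.
Proof.
move=> w0.
have L1 : is_lim_seq (fun n => Cmod w * / INR n.+1) 0.
  by rewrite -(Rmult_0_r (Cmod w)); apply: (is_lim_seq_scal_l _ (Cmod w) 0); exact: is_lim_seq_inv_S.
have Ra : is_lim_seq (fun n => Im w / (Re w + INR n.+1)) 0.
  apply: (is_lim_seq_le_le (fun n => - (Cmod w * / INR n.+1)) _ (fun n => Cmod w * / INR n.+1)) => //.
    move=> n; have hn := INR_S_gt0 n.
    have im : Rabs (Im w) <= Cmod w by apply: Rle_trans (Rmax_Cmod w); exact: Rmax_r.
    apply/Rabs_le_between; rewrite Rabs_div; last lra.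
    apply: Rmult_le_compat; [exact: Rabs_pos| |done|].
      by apply/Rlt_le/Rinv_0_lt_compat; rewrite Rabs_pos_eq; lra.
    by apply: Rinv_le_contravar => //; rewrite Rabs_pos_eq; lra.
  by have := proj1 (is_lim_seq_opp _ _) L1; rewrite /= Ropp_0.
have L2 : is_lim_seq (fun n => Rabs (atan (Im w / (Re w + INR n.+1)))) 0.
  rewrite -Rabs_R0; apply: (is_lim_seq_abs _ 0); rewrite -atan_0.
  by apply: is_lim_seq_continuous => //; apply/continuity_pt_filterlim; exact: continuous_atan.
apply: (is_lim_seq_le_le (fun=> 0) _ (fun n => Cmod w * / INR n.+1 + Rabs (atan (Im w / (Re w + INR n.+1))))).
- move=> n; split; first exact: Cmod_ge_0.
  apply: Rle_trans (Cmod_le_abs _) _.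
  have hn := INR_S_gt0 n.
  have im : Im (Clog (w + INR n.+1) - ln (INR n.+1)) = atan (Im w / (Re w + INR n.+1)).
    have -> : Im (Clog (w + INR n.+1) - ln (INR n.+1)) = Carg (w + INR n.+1)%C - 0 by [].
    rewrite Rminus_0_r Carg_atan Re_add_INR; last lra.
    by have -> : Im (w + INR n.+1)%C = Im w + 0 by []; rewrite Rplus_0_r.
  rewrite im; apply: Rplus_le_compat_r.
  have -> : Re (Clog (w + INR n.+1) - ln (INR n.+1)) = ln (Cmod (w + INR n.+1)) - ln (INR n.+1) by [].
  (* With N = n + 1 the quotient q = |w + N| / N lies between 1 and 1 + |w| / N, and 0 <= ln q <= q
     - 1. *)
  have h1 : INR n.+1 <= Cmod (w + INR n.+1).
    have := re_le_Cmod (w + INR n.+1)%C; rewrite Re_add_INR.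
    by have := Rle_abs (Re w + INR n.+1); lra.
  have h2 : Cmod (w + INR n.+1) <= Cmod w + INR n.+1.
    by apply: Rle_trans (Cmod_triangle _ _) _; rewrite Cmod_R Rabs_pos_eq; lra.
  rewrite -ln_div //; last lra.
  have q0 : 1 <= Cmod (w + INR n.+1) / INR n.+1.
    by apply: (Rmult_le_reg_r (INR n.+1)) => //; rewrite /Rdiv Rmult_assoc Rinv_l; lra.
  have l0 : 0 <= ln (Cmod (w + INR n.+1) / INR n.+1) by rewrite -ln_1; apply: ln_le; lra.
  rewrite Rabs_pos_eq //.
  have := exp_ineq1_le (ln (Cmod (w + INR n.+1) / INR n.+1)); rewrite exp_ln; last lra.
  have : Cmod (w + INR n.+1) / INR n.+1 <= Cmod w * / INR n.+1 + 1.
    apply: (Rmult_le_reg_r (INR n.+1)) => //; rewrite /Rdiv Rmult_plus_distr_r !Rmult_assoc Rinv_l; lra.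
  lra.
- exact: is_lim_seq_const.
- by rewrite -(Rplus_0_r 0); apply: is_lim_seq_plus'.
Qed.

(** * Inverse factorial series *)

Lemma Crising0 z : Crising z 0 = RtoC 1.
Proof. by rewrite /Crising big_ord0. Qed.

Lemma CrisingSl z m : Crising z m.+1 = (z * Crising (z + 1) m)%C.
Proof.
rewrite /Crising big_ord_recl Cplus_0_r; congr (_ * _)%C.
apply: eq_bigr => i _; rewrite -Cplus_assoc; congr (_ + _)%C.
by rewrite lift0 S_INR RtoC_plus Cplus_comm.
Qed.

Lemma CrisingSr z m : Crising z m.+1 = (Crising z m * (z + INR m))%C.
Proof.
elim: m z => [|m IH] z; first by rewrite CrisingSl !Crising0 Cplus_0_r; ring.
by rewrite CrisingSl IH CrisingSl S_INR RtoC_plus; ring.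
Qed.

Lemma Crising_neq0 z m : 0 < Re z -> Crising z m <> RtoC 0.
Proof.
move=> z0; elim: m => [|m IH]; first by rewrite Crising0 => /(f_equal fst) /=; lra.
rewrite CrisingSr; apply: Cmult_neq_0 => //; apply: Cneq0_Re.
by rewrite Re_add_INR; have := pos_INR m; lra.
Qed.

(* m! / (x)_(m+1) *)
Fixpoint fact_ratio (x : R) (m : nat) : R :=
  if m is n.+1 then fact_ratio x n * (INR n.+1 / (x + INR n.+1)) else / x.

Lemma fact_ratioS x m : fact_ratio x m.+1 = fact_ratio x m * (INR m.+1 / (x + INR m.+1)).
Proof. by []. Qed.

Lemma fact_ratio_gt0 x m : 0 < x -> 0 < fact_ratio x m.
Proof.
move=> x0; elim: m => [|m IH]; first exact: Rinv_0_lt_compat.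
have h := INR_S_gt0 m; apply: Rmult_lt_0_compat => //.
by apply: Rdiv_lt_0_compat; lra.
Qed.

Lemma fact_ratio_sub x m : 0 < x ->
  fact_ratio x m - fact_ratio x m.+1 = x * fact_ratio x m / (x + INR m.+1).
Proof.
move=> x0; have h := INR_S_gt0 m.
by rewrite fact_ratioS; field; lra.
Qed.

Lemma Cmod_Crising_ge z m : 0 < Re z -> INR (fact m) / Cmod (Crising z m.+1) <= fact_ratio (Re z) m.
Proof.
move=> z0.
have pos k : 0 < Cmod (Crising z k) by apply/Cmod_gt_0/Crising_neq0.
have ge k : Re z + INR k <= Cmod (z + INR k).
  have := re_le_Cmod (z + INR k)%C; rewrite Re_add_INR.
  by have := Rle_abs (Re z + INR k); lra.
elim: m => [|m IH].
  have := ge 0%nat; have := pos 1%nat.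
  rewrite CrisingSr Crising0 Cmult_1_l /Rdiv Rmult_1_l /= Rplus_0_r => p g.
  exact: Rinv_le_contravar.
have h := INR_S_gt0 m; have g := ge m.+1; have p := pos m.+1.
rewrite CrisingSr Cmod_mult fact_simpl mult_INR fact_ratioS.
rewrite (_ : _ / _ = INR (fact m) / Cmod (Crising z m.+1) * (INR m.+1 / Cmod (z + INR m.+1))); last first.
  by field; lra.
apply: Rmult_le_compat => //.
- by apply: Rdiv_le_0_compat => //; apply: pos_INR.
- by apply: Rdiv_le_0_compat; lra.
- by apply: Rmult_le_compat_l; [lra|apply: Rinv_le_contravar; lra].
Qed.

(* Divergence of the harmonic series forces this sequence to vanish. *)
Lemma fact_ratio_log x m : 0 < x -> fact_ratio x m * (x * (1 + x * ln (INR m.+1))) <= 1.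
Proof.
move=> x0; elim: m => [|m IH].
  by rewrite /= ln_1 Rmult_0_r Rplus_0_r Rmult_1_r Rinv_l; lra.
apply: Rle_trans IH; have h := INR_S_gt0 m; have f0 := fact_ratio_gt0 x m x0.
rewrite fact_ratioS Rmult_assoc.
apply: Rmult_le_compat_l; first lra.
have l0 : 0 <= ln (INR m.+1).
  by rewrite -ln_1; apply: ln_le; [lra|rewrite S_INR; have := pos_INR m; lra].
have l1 : ln (INR m.+2) <= ln (INR m.+1) + / INR m.+1.
  have := exp_ineq1_le (ln (INR m.+2) - ln (INR m.+1)).
  rewrite exp_plus exp_Ropp !exp_ln //; last exact: INR_S_gt0.
  rewrite (S_INR m.+1) Rmult_plus_distr_r Rinv_r; lra.
apply: (Rmult_le_reg_l (x + INR m.+1)); first lra.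
rewrite (_ : (x + INR m.+1) * (INR m.+1 / (x + INR m.+1) * (x * (1 + x * ln (INR m.+2)))) =
  x * (INR m.+1 + x * (INR m.+1 * ln (INR m.+2)))); last by field; lra.
(* With N = m + 1 the claim is N (1 + x ln (N + 1)) <= (x + N) (1 + x ln N); by this bound it holds
   with slack x^2 ln N. *)
have l2 : INR m.+1 * ln (INR m.+2) <= INR m.+1 * ln (INR m.+1) + 1.
  rewrite (_ : _ + 1 = INR m.+1 * (ln (INR m.+1) + / INR m.+1)); last by field; lra.
  by apply: Rmult_le_compat_l; lra.
have l3 : 0 <= x * (x * ln (INR m.+1)) by apply: Rmult_le_pos; [lra|apply: Rmult_le_pos; lra].
move: (INR m.+1) (ln (INR m.+1)) (ln (INR m.+2)) h l0 l1 l2 l3 => N L L' h l0 l1 l2 l3.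
have : x * (x * (N * L')) <= x * (x * (N * L + 1)).
  by apply: Rmult_le_compat_l; [lra|apply: Rmult_le_compat_l; lra].
nra.
Qed.

Lemma fact_ratio_lim x : 0 < x -> is_lim_seq (fact_ratio x) 0.
Proof.
move=> x0.
have L : is_lim_seq (fun m => x * x * ln (INR m.+1)) p_infty.
  have -> : p_infty = Rbar_mult (x * x) p_infty.
    have xx : 0 < x * x by apply: Rmult_lt_0_compat.
    by rewrite /Rbar_mult /Rbar_mult' /=; case: Rle_dec => h; [case: Rle_lt_or_eq_dec => h'; [|lra]|lra].
  apply: is_lim_seq_scal_l.
  apply: (is_lim_comp_seq ln _ p_infty p_infty); first exact: is_lim_ln_p.
    by exists 0%nat.
  exact/(is_lim_seq_incr_1 INR)/is_lim_seq_INR.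
apply: (is_lim_seq_le_le_loc (fun=> 0) _ (fun m => / (x * x * ln (INR m.+1)))).
- exists 1%nat => m Hm; split; first exact/Rlt_le/fact_ratio_gt0.
  have f0 := fact_ratio_gt0 x m x0; have := fact_ratio_log x m x0.
  have l0 : 0 < ln (INR m.+1).
    rewrite -ln_1; apply: ln_increasing; first lra.
    by rewrite S_INR; have := le_INR _ _ Hm; rewrite /=; lra.
  have xl : 0 < x * x * ln (INR m.+1) by apply: Rmult_lt_0_compat => //; apply: Rmult_lt_0_compat.
  move=> h; apply: (Rmult_le_reg_r (x * x * ln (INR m.+1))) => //.
  rewrite Rinv_l; last lra.
  nra.
- exact: is_lim_seq_const.
- by apply: (is_lim_seq_inv _ p_infty).
Qed.

(** The factor 0 - x is at most 1 in absolute value, and k - x at most k for k >= 1. *)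
Lemma Rabs_npoch_le x m : 0 <= x <= 1 -> Rabs (npoch x m.+1) <= INR (fact m).
Proof.
move=> Hx; elim: m => [|m IH].
  by rewrite /= Rmult_1_l; apply: Rabs_le; lra.
rewrite npochS Rabs_mult fact_simpl mult_INR Rmult_comm.
apply: Rmult_le_compat => //; try exact: Rabs_pos.
by apply: Rabs_le; rewrite S_INR; have := pos_INR m; lra.
Qed.

Lemma Rabs_npoch_int_le m : Rabs (npoch_int m.+1) <= INR (fact m).
Proof.
rewrite (_ : INR (fact m) = (1 - 0) * INR (fact m)); last by ring.
apply: norm_RInt_le_const _ _ (is_RInt_npoch m.+1); first lra.
by move=> x Hx; apply: Rabs_npoch_le.
Qed.

(** Newton's expansion with its exact remainder. The induction step is 1 / (z + x) - 1 / (z + k) =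
    (k - x) / ((z + k) (z + x)). *)
Lemma inv_add_expansion (z : C) (x : R) M : 0 < Re z -> 0 <= x ->
  (/ (z + x) - sum_n (fun m => npoch x m / Crising z m.+1) M =
   npoch x M.+1 / (Crising z M.+1 * (z + x)))%C.
Proof.
move=> z0 x0.
have zx : (z + x)%C <> RtoC 0 by apply: Cneq0_Re; have -> : Re (z + x)%C = Re z + x by []; lra.
have z1 := Cneq0_Re z z0.
elim: M => [|M IH].
  have -> : npoch x 1 = - x by rewrite npochS /=; ring.
  by rewrite sum_O CrisingSr Crising0 Cplus_0_r Cmult_1_l RtoC_opp [npoch x 0]/=; field.
rewrite sum_Sn.
set S := sum_n _ M in IH *; set a := (_ / _)%C.
have -> : (/ (z + x) - plus S a = (/ (z + x) - S) - a)%C by change (/ (z + x) - (S + a) = (/ (z + x) - S) - a)%C; ring.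
rewrite IH /a (CrisingSr z M.+1) (npochS x M.+1) RtoC_mult RtoC_minus.
have h1 := Crising_neq0 z M.+1 z0.
have h2 : (z + INR M.+1)%C <> RtoC 0.
  by apply: Cneq0_Re; rewrite Re_add_INR; have := INR_S_gt0 M; lra.
move: (INR M.+1) (npoch x M.+1) (Crising z M.+1) h1 h2 => N P Q h1 h2.
by field.
Qed.

Lemma is_RInt_RtoC (f : R -> R) a b l :
  is_RInt f a b l -> is_RInt (V := C_R_NormedModule) (fun t => RtoC (f t)) a b (RtoC l).
Proof.
move=> H; apply: is_RInt_C => //=; have := is_RInt_const (V := R_NormedModule) a b 0.
by rewrite /scal /= /mult /= Rmult_0_r.
Qed.

Lemma is_RInt_expansion (z : C) M :
  is_RInt (V := C_R_NormedModule)
    (fun x : R => sum_n (fun m => npoch x m / Crising z m.+1)%C M) 0 1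
    (sum_n (fun m => npoch_int m / Crising z m.+1)%C M).
Proof.
have H m : is_RInt (V := C_R_NormedModule) (fun x : R => npoch x m / Crising z m.+1)%C 0 1
    (npoch_int m / Crising z m.+1)%C.
  have := is_RInt_Cmult_l (/ Crising z m.+1)%C _ _ _ _ (is_RInt_RtoC _ _ _ _ (is_RInt_npoch m)).
  by rewrite Cmult_comm; apply: is_RInt_ext => x _; rewrite Cmult_comm.
elim: M => [|M IH].
  by rewrite sum_O; apply: is_RInt_ext (H 0%nat) => x _; rewrite sum_O.
by rewrite sum_Sn; apply: is_RInt_ext (is_RInt_plus _ _ _ _ _ _ IH (H M.+1)) => x _; rewrite sum_Sn.
Qed.

(** The remainder of the Newton expansion is bounded uniformly for x in [0, 1] by a null sequence,
    so integrating the partial sums suffices. *)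
Lemma is_series_Clog_sub (z : C) : 0 < Re z ->
  is_series (V := C_NormedModule) (fun m => npoch_int m / Crising z m.+1)%C (Clog (z + 1) - Clog z)%C.
Proof.
move=> z0; set l := (_ - _)%C.
have H M : Cmod (l - sum_n (fun m => npoch_int m / Crising z m.+1)%C M) <= / Re z * fact_ratio (Re z) M.
  have HI := is_RInt_minus _ _ _ _ _ _ (is_RInt_inv_Clog z z0) (is_RInt_expansion z M).
  apply: Cmod_RInt01_le HI => x Hx.
  change (Cmod (/ (z + x) - sum_n (fun m => npoch x m / Crising z m.+1)%C M) <= / Re z * fact_ratio (Re z) M).
  have zx : Re z <= Cmod (z + x).
    have := re_le_Cmod (z + x)%C; have -> : Re (z + x)%C = Re z + x by [].
    by have := Rle_abs (Re z + x); lra.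
  rewrite inv_add_expansion //; last lra.
  have h1 := Crising_neq0 z M.+1 z0.
  have c0 : 0 < Cmod (Crising z M.+1) by apply/Cmod_gt_0.
  rewrite Cmod_div; last by apply: Cmult_neq_0 => //; apply/Cmod_gt_0; lra.
  rewrite Cmod_R Cmod_mult.
  rewrite (_ : _ / _ = / Cmod (z + x) * (Rabs (npoch x M.+1) / Cmod (Crising z M.+1))); last by field; lra.
  apply: Rmult_le_compat.
  - by apply/Rlt_le/Rinv_0_lt_compat; lra.
  - by apply: Rdiv_le_0_compat => //; apply: Rabs_pos.
  - exact: Rinv_le_contravar.
  - apply: Rle_trans (Cmod_Crising_ge z M z0); apply: Rmult_le_compat_r; last exact: Rabs_npoch_le.
    by apply/Rlt_le/Rinv_0_lt_compat.
have L : is_lim_seq (fun M => / Re z * fact_ratio (Re z) M) 0.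
  rewrite -(Rmult_0_r (/ Re z)); apply: (is_lim_seq_scal_l _ (/ Re z) 0); exact: fact_ratio_lim.
move=> P [eps He]; have /is_lim_seq_spec /(_ eps) := L.
rewrite /filtermap; apply: filter_imp => M; rewrite Rminus_0_r => /Rabs_def2 [h _].
apply: He; apply: (norm_compat1 (V := C_R_NormedModule)).
rewrite norm_C; apply: Rle_lt_trans h; apply: Rle_trans (H M).
rewrite -Cmod_opp; apply/Req_le; congr Cmod.
by change (- (sum_n (fun m => npoch_int m / Crising z m.+1)%C M - l) = l - sum_n (fun m => npoch_int m / Crising z m.+1)%C M)%C; ring.
Qed.

(** * The factorial series of the theorem and its behaviour under z -> z + 1 *)

Definition fterm (z : C) (n : nat) : C := (p1 n.+2 / Crising z n.+2)%C.

Lemma Rabs_p1_le n : Rabs (p1 n.+2) <= INR (fact n.+1) / INR n.+2.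
Proof.
have h := INR_S_gt0 n.+1.
apply: (Rmult_le_reg_l (INR n.+2)) => //.
rewrite -{1}(Rabs_pos_eq (INR n.+2)); last lra.
rewrite -Rabs_mult p1E Rabs_Ropp.
apply: Rle_trans (Rabs_npoch_int_le n.+1) _; apply/Req_le; field; lra.
Qed.

(** With x = Re z, N = n + 2 and f = [fact_ratio x], the term is at most f(n+1) / N, while f(n+1) -
    f(n+2) = x f(n+1) / (x + N). The constant comes from x + N <= (1 + x) N. *)
Lemma Cmod_fterm_le z n : 0 < Re z ->
  Cmod (fterm z n) <= (1 + Re z) / Re z * (fact_ratio (Re z) n.+1 - fact_ratio (Re z) n.+2).
Proof.
move=> z0; have x0 := z0; set x := Re z in x0 *.
have c0 : 0 < Cmod (Crising z n.+2) by apply/Cmod_gt_0/Crising_neq0.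
have h := INR_S_gt0 n.+1; have f0 := fact_ratio_gt0 x n.+1 x0.
rewrite fact_ratio_sub // Cmod_div; last exact: Crising_neq0.
rewrite Cmod_R; have := Cmod_Crising_ge z n.+1 z0; rewrite -/x => hc.
apply: (Rle_trans _ (fact_ratio x n.+1 * / INR n.+2)).
  apply: (Rle_trans _ (INR (fact n.+1) / INR n.+2 / Cmod (Crising z n.+2))).
    by apply: Rmult_le_compat_r (Rabs_p1_le n); apply/Rlt_le/Rinv_0_lt_compat.
  rewrite (_ : _ / _ / _ = INR (fact n.+1) / Cmod (Crising z n.+2) * / INR n.+2); last by field; lra.
  by apply: Rmult_le_compat_r hc; apply/Rlt_le/Rinv_0_lt_compat.
rewrite (_ : (1 + x) / x * _ = fact_ratio x n.+1 * ((1 + x) / (x + INR n.+2))); last by field; lra.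
apply: Rmult_le_compat_l; first lra.
apply: (Rmult_le_reg_r (INR n.+2 * (x + INR n.+2))); first by apply: Rmult_lt_0_compat; lra.
rewrite (_ : / INR n.+2 * _ = x + INR n.+2); last by field; lra.
rewrite (_ : (1 + x) / _ * _ = (1 + x) * INR n.+2); last by field; lra.
have : 1 <= INR n.+2 by rewrite S_INR; have := pos_INR n.+1; lra.
nra.
Qed.

Lemma fterm_series z : 0 < Re z ->
  exists s : C, is_series (V := C_NormedModule) (fterm z) s /\ Cmod s <= (1 + Re z) / (Re z * Re z).
Proof.
move=> z0; set x := Re z in z0 *; set k := (1 + x) / x.
have k0 : 0 < k by apply: Rdiv_lt_0_compat; lra.
have b1 : fact_ratio x 1 <= / x.
  have := fact_ratio_sub x 0 z0; have := fact_ratio_gt0 x 0 z0; have h := INR_S_gt0 0.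
  have e : fact_ratio x 0 = / x by [].
  move=> f0; have : 0 < x * fact_ratio x 0 / (x + INR 1).
    by apply: Rdiv_lt_0_compat; [apply: Rmult_lt_0_compat|lra].
  by rewrite e; lra.
have S N : sum_n (fun n => k * (fact_ratio x n.+1 - fact_ratio x n.+2)) N = k * (fact_ratio x 1 - fact_ratio x N.+2).
  by elim: N => [|N IH]; rewrite ?sum_O // sum_Sn IH /plus /=; ring.
have Ex : ex_series (fun n => k * (fact_ratio x n.+1 - fact_ratio x n.+2)).
  exists (k * (fact_ratio x 1 - 0)).
  change (is_lim_seq (sum_n (fun n => k * (fact_ratio x n.+1 - fact_ratio x n.+2))) (k * (fact_ratio x 1 - 0))).
  apply: (is_lim_seq_ext (fun N => k * (fact_ratio x 1 - fact_ratio x N.+2))); first by move=> n; rewrite S.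
  apply: (is_lim_seq_scal_l _ k (fact_ratio x 1 - 0)); apply: is_lim_seq_minus'; first exact: is_lim_seq_const.
  by apply/(is_lim_seq_incr_1 (fun n => fact_ratio x n.+1))/(is_lim_seq_incr_1 (fact_ratio x)); exact: fact_ratio_lim.
have [s Hs] := ex_series_le (V := C_CompleteNormedModule) (fterm z) _ (fun n => Cmod_fterm_le z n z0) Ex.
exists s; split=> //.
have bnd N : Cmod (sum_n (G := C_AbelianGroup) (fterm z) N) <= k * (fact_ratio x 1 - fact_ratio x N.+2).
  elim: N => [|N IH]; first by rewrite sum_O; apply: Cmod_fterm_le.
  rewrite sum_Sn; apply: Rle_trans (Cmod_triangle _ _) _.
  by have := Cmod_fterm_le z N.+1 z0; rewrite -/x -/k; lra.
(* By continuity of the norm the telescoped bound on the partial sums passes to [s]. *)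
have L : is_lim_seq (fun N => Cmod (sum_n (G := C_AbelianGroup) (fterm z) N)) (Cmod s).
  exact: (filterlim_comp _ _ _ _ _ _ _ _ Hs (filterlim_norm (K := C_AbsRing) (V := C_NormedModule) s)).
have := is_lim_seq_le _ (fun=> k * / x) _ _ _ L (is_lim_seq_const _).
rewrite (_ : (1 + x) / (x * x) = k * / x); last by rewrite /k; field; lra.
apply=> N; apply: Rle_trans (bnd N) _; apply: Rmult_le_compat_l; first lra.
by have := fact_ratio_gt0 x N.+2 z0; lra.
Qed.

Lemma npoch_int0 : npoch_int 0 = 1.
Proof.
rewrite /npoch_int; apply: is_RInt_unique.
have := is_RInt_const (V := R_NormedModule) 0 1 1.
by rewrite /scal /= /mult /= Rminus_0_r Rmult_1_l.
Qed.

Lemma npoch_int1 : npoch_int 1 = - / 2.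
Proof.
rewrite /npoch_int; apply: is_RInt_unique.
rewrite (_ : - / 2 = minus (- (1 * 1 / 2)) (- (0 * 0 / 2))); last by rewrite /minus /plus /opp /=; field.
apply: (is_RInt_ext (fun x => - x)); first by move=> x _ /=; ring.
apply: (is_RInt_derive (fun x => - (x * x / 2))) => x _; first by auto_derive => //; field.
exact: (continuous_opp (V := R_NormedModule) _ _ (continuous_id _)).
Qed.

Lemma Re_add1 (z : C) : Re (z + 1)%C = Re z + 1.
Proof. by []. Qed.

Lemma fterm_sub z n : 0 < Re z ->
  (fterm z n - fterm (z + 1) n = - (npoch_int n.+2 / Crising z n.+3))%C.
Proof.
move=> z0; have z1 := Cneq0_Re z z0; rewrite /fterm.
have r0 := Crising_neq0 z n.+2 z0.
have r1 : Crising (z + 1) n.+2 <> RtoC 0 by apply: Crising_neq0; rewrite Re_add1; lra.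
have w0 : (z + INR n.+2)%C <> RtoC 0.
  by apply: Cneq0_Re; rewrite Re_add_INR; have := INR_S_gt0 n.+1; lra.
have E : Crising (z + 1) n.+2 = (Crising z n.+2 * (z + INR n.+2) / z)%C.
  by rewrite -CrisingSr (CrisingSl z); field.
have -> : npoch_int n.+2 = - (INR n.+2 * p1 n.+2) by rewrite p1E; ring.
rewrite E (CrisingSr z n.+2) RtoC_opp RtoC_mult.
move: (INR n.+2) (p1 n.+2) (Crising z n.+2) w0 r0 => N p c w0 r0.
by field.
Qed.

(** The terms m = 0 and m = 1 of the logarithmic series, 1 / z and - 1 / (2 z (z + 1)), have no
    counterpart in [fterm]. The second one accounts for - 1 / (2 z) in the expansion, since 1 / (2
    z) - 1 / (2 (z + 1)) = 1 / (2 z (z + 1)). *)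
Lemma fterm_series_sub (z s s' : C) : 0 < Re z ->
  is_series (V := C_NormedModule) (fterm z) s ->
  is_series (V := C_NormedModule) (fterm (z + 1)) s' ->
  (s - s' = / z - / (2 * (z * (z + 1))) - (Clog (z + 1) - Clog z))%C.
Proof.
move=> z0 Hs Hs'; have z1 := Cneq0_Re z z0.
have z2 : (z + 1)%C <> RtoC 0 by apply: Cneq0_Re; rewrite Re_add1; lra.
set L := (Clog (z + 1) - Clog z)%C.
have H0 := is_series_Clog_sub z z0; rewrite -/L in H0.
pose a m : C := (npoch_int m / Crising z m.+1)%C.
have H1 : is_series (V := C_NormedModule) (fun m => a m.+2) (L - a 0%nat - a 1%nat)%C.
  apply: (is_series_incr_1 (V := C_NormedModule) (fun m => a m.+1)).
  apply: (is_series_incr_1 (V := C_NormedModule) a).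
  rewrite (_ : plus _ _ = L) //.
  by change (L - a 0%nat - a 1%nat + a 1%nat + a 0%nat = L)%C; ring.
have H2 := is_series_opp _ _ H1.
have H3 := is_series_minus _ _ _ _ Hs Hs'.
have H4 : is_series (V := C_NormedModule) (fun m => opp (a m.+2)) (s - s')%C.
  by apply: is_series_ext H3 => n; exact: fterm_sub.
have := filterlim_locally_unique _ _ _ H4 H2 => ->.
change (- (L - a 0%nat - a 1%nat) = / z - / (2 * (z * (z + 1))) - L)%C.
rewrite /a npoch_int0 npoch_int1 !CrisingSr Crising0 Cplus_0_r !Cmult_1_l RtoC_opp RtoC_inv; last lra.
have -> : INR 1 = 1 by [].
by field; repeat split => //; move=> /(f_equal fst) /=; lra.
Qed.

(** The sum at z + n is a variable [w] tied to the series by convergence; it is general in the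
    induction, and uniqueness of limits settles n = 0. *)
Lemma factorial_series_defect (z s : C) n (w : C) : 0 < Re z -> is_series (V := C_NormedModule) (fterm z) s ->
  is_series (V := C_NormedModule) (fterm (z + INR n)) w ->
  (digamma (z + INR n) - (Clog (z + INR n) - 1 / (2 * (z + INR n)) - w) =
   digamma z - (Clog z - 1 / (2 * z) - s))%C.
Proof.
move=> z0 Hs; elim: n w => [|n IH] w.
  by rewrite Cplus_0_r => Hw; rewrite (filterlim_locally_unique _ _ _ Hw Hs).
have -> : (z + INR n.+1 = z + INR n + 1)%C by rewrite S_INR RtoC_plus; ring.
set y := (z + INR n)%C in IH *.
have y0 : 0 < Re y by rewrite Re_add_INR; have := pos_INR n; lra.
move=> Hw; have [v [Hv _]] := fterm_series y y0.
rewrite -(IH v Hv) digamma_add1 //.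
have := fterm_series_sub y v w y0 Hv Hw.
have y1 := Cneq0_Re y y0.
have y2 : (y + 1)%C <> RtoC 0 by apply: Cneq0_Re; rewrite Re_add1; lra.
move=> E; have -> : w = (v - (/ y - / (2 * (y * (y + 1))) - (Clog (y + 1) - Clog y)))%C.
  by rewrite -E; ring.
by field; split.
Qed.

Lemma digamma_factorial_series (z s : C) : 0 < Re z -> is_series (V := C_NormedModule) (fterm z) s ->
  digamma z = (Clog z - 1 / (2 * z) - s)%C.
Proof.
move=> z0 Hs; set D := (_ - _ - _)%C.
suff : Cmod (digamma z - D) <= 0.
  move=> h; have /Cmod_eq_0 h2 : Cmod (digamma z - D) = 0 by have := Cmod_ge_0 (digamma z - D); lra.
  by rewrite -(Cplus_0_r D) -h2; ring.
have z1 : 0 < Re (z + 1)%C by rewrite Re_add1; lra.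
(* The constant defect is bounded by a null sequence. With y = z + 1 + N, N = n + 1, the last
   summand 3 / N collects |1 / (2 y)| <= 1 / Re y and |w| <= (1 + Re y) / (Re y)^2 <= 2 / Re y. *)
have L : is_lim_seq (fun n => Cmod (digamma (z + 1 + INR n.+1) - ln (INR n.+1)) +
    Cmod (Clog (z + 1 + INR n.+1) - ln (INR n.+1)) + 3 * / INR n.+1) (0 + 0 + 3 * 0).
  apply: is_lim_seq_plus'; last by apply: (is_lim_seq_scal_l _ 3 0); exact: is_lim_seq_inv_S.
  apply: is_lim_seq_plus'; [exact: digamma_sub_ln_limit|exact: Clog_sub_ln_limit].
rewrite (_ : 0 + 0 + 3 * 0 = 0) in L; last by ring.
apply: (is_lim_seq_le (fun=> Cmod (digamma z - D)) _ (Cmod (digamma z - D)) 0 _ (is_lim_seq_const _) L) => n.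
have hn := INR_S_gt0 n; have n1 : 1 <= INR n.+1 by rewrite S_INR; have := pos_INR n; lra.
have y2 : (z + 1 + INR n.+1 = z + INR n.+2)%C by rewrite (S_INR n.+1) RtoC_plus; ring.
set y := (z + 1 + INR n.+1)%C in y2 *.
have ry : Re y = Re z + 1 + INR n.+1 by [].
have y0 : 0 < Re y by lra.
have [w [Hw bw]] := fterm_series y y0.
have y3 := Cneq0_Re y y0.
have := factorial_series_defect z s n.+2 w z0 Hs; rewrite -y2 => /(_ Hw) <-.
rewrite (_ : (digamma y - _)%C = ((digamma y - ln (INR n.+1)) + - (Clog y - ln (INR n.+1)) + (1 / (2 * y) + w))%C); last by ring.
apply: Rle_trans (Cmod_triangle _ _) _; apply: Rplus_le_compat.
  by apply: Rle_trans (Cmod_triangle _ _) _; rewrite Cmod_opp; apply: Rle_refl.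
apply: Rle_trans (Cmod_triangle _ _) _.
have iy : / Re y <= / INR n.+1 by apply: Rinv_le_contravar; lra.
have iy0 : 0 < / Re y by apply: Rinv_0_lt_compat.
have b1 : Cmod (1 / (2 * y)) <= / Re y.
  have cy : Re y <= Cmod y by have := re_le_Cmod y; have := Rle_abs (Re y); lra.
  have i2 : / Cmod y <= / Re y by apply: Rinv_le_contravar.
  have i3 : 0 < / Cmod y by apply: Rinv_0_lt_compat; lra.
  rewrite Cmod_div; last by apply: Cmult_neq_0 => //; move=> /(f_equal fst) /=; lra.
  rewrite Cmod_mult Cmod_1 Cmod_R Rabs_pos_eq; last lra.
  rewrite (_ : 1 / (2 * Cmod y) = / 2 * / Cmod y); [lra|field; lra].
have b2 : (1 + Re y) / (Re y * Re y) <= 2 * / Re y.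
  rewrite (_ : _ / _ = (1 + Re y) / Re y * / Re y); last by field; lra.
  apply: Rmult_le_compat_r; first lra.
  apply: (Rmult_le_reg_r (Re y)) => //; rewrite /Rdiv Rmult_assoc Rinv_l; lra.
lra.
Qed.

(* The series is indexed by n = m - 2.  The second part says that bpol m is a
   polynomial function of alpha whose coefficient of alpha is p1 m. *)
Theorem mainTheorem10 :
  (forall z : C, (0 < Re z)%R ->
     exists s : C,
       is_series (V := C_NormedModule)
         (fun n : nat => (p1 n.+2 / Crising z n.+2)%C) s /\
       digamma z = (Clog z - 1 / (2 * z) - s)%C) /\
  (forall m : nat, (2 <= m)%nat ->
     exists p : {poly R},
       (forall alpha : R, bpol m alpha = (p.[alpha])%ring) /\ (p`_1)%ring = p1 m).
Proof.
split=> [z z0|m m2].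
  have [s [Hs _]] := fterm_series z z0.
  by exists s; split=> //; apply: digamma_factorial_series.
exists (bpoly m); split=> [alpha|]; first exact: bpolE.
by case: m m2 => [|[|m]] // _; apply: bpoly_coef1.
Qed.
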